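(* Suppose $\mathcal{M}$ is a uniformly bounded in variation family of topological measures (respectively, deficient topological measures) on a locally compact metric space $(X,d)$, $q_i$ is an image transformation (respectively, a d-image transformation) on $X$ with contractivity factor $s_i\le s<1$, $\alpha_i\ge0$ for $i=1,2,\ldots$, and $\sum_{i=1}^\infty\alpha_i\le1$. Let the representable (deficient) topological measure $\mu_0$ be the unique fixed point in $\mathcal{M}$ of the Markov operator $S(\mu)=\sum_{i=1}^\infty\alpha_i\,q_i^*(\mu)$, and let $D_0=D^{\mu_0}$. Let $m_0$ be the probability measure on $X^\sharp$ (respectively, on $X^\flat$) which is the unique fixed point of the Markov operator $M(m)=\sum_{i=1}^\infty\alpha_i\,m\circ(q_i^* )^{-1}$, with $q_i^*:X^\sharp\to X^\sharp$ (respectively, $q_i^*:X^\flat\to X^\flat$) as contraction maps. Then: (1) $S(m\circ\Lambda)=(M(m))\circ\Lambda$ for any probability measure $m$ on $X^\sharp$ (respectively, on $X^\flat$). (2) $\mu_0=m_0\circ\Lambda$. (3) If $\sum_{i=1}^\infty\alpha_i=1$, then $q_i^*(D_0)\subseteq D_0$ for each $i$. For finitely many (d-) image transformations $q_1,\dots,q_n$ and $\sum_{i=1}^n\alpha_i=1$, let $W(F)=\bigcup_{i=1}^n q_i^*(F)$ for closed $F\subseteq X^\sharp$ (respectively, $F\subseteq X^\flat$), and let $A$ be its attractor. Then: (i) $W(D_0)\subseteq D_0$. (ii) $A=\operatorname{supp} m_0\subseteq D_0$. (iii) If $\mu_0$ is a simple topological measure, then $A=\operatorname{supp} m_0=D_0=\{\mu_0\}$,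 so $m_0$ is the point mass at $\mu_0$.
   Context: All spaces are Hausdorff. $\mathscr{O}(X),\mathscr{C}(X),\mathscr{K}(X)$ denote the open, closed, compact subsets of $X$; $\sqcup$ is disjoint union. A topological measure on a locally compact $X$ is a map $\mu:\mathscr{C}(X)\cup\mathscr{O}(X)\to[0,\infty]$, not identically $\infty$, such that: (TM1) if $A,B,A\sqcup B\in\mathscr{K}(X)\cup\mathscr{O}(X)$ then $\mu(A\sqcup B)=\mu(A)+\mu(B)$; (TM2) $\mu(U)=\sup\{\mu(K):K\in\mathscr{K}(X),K\subseteq U\}$ for open $U$; (TM3) $\mu(F)=\inf\{\mu(U):U\in\mathscr{O}(X),F\subseteq U\}$ for closed $F$. If (TM1) is required only for compact $A,B$, $\mu$ is a deficient topological measure. $\|\mu\|=\mu(X)$; $\mu$ is finite if $\mu(X)<\infty$. A family $\mathcal{M}$ of finite (deficient) topological measures is uniformly bounded in variation if there is a constant $L>0$ with $\|\mu\|\le L$ for each $\mu\in\mathcal{M}$. A (deficient) topological measure is simple if it only assumes values $0$ and $1$. $X^\sharp$ (respectively, $X^\flat$) is the set of simple topological (respectively, simple deficient topological) measures on $X$; for $E\subseteq X$ open or closed, $E^\sharp=\{\mu\in X^\sharp:\mu(E)=1\}$, $E^\flat=\{\mu\in X^\flat:\mu(E)=1\}$. For $E$ open or compact, $\Lambda(E)=E^\sharp$ (respectively, $\Lambda(E)=E^\flat$), and $(m\circ\Lambda)(E)=m(\Lambda(E))$. $C(X)$: continuous real-valued functions; $C_0(X)$: those $f\in C(X)$ with $\{|f|\ge\epsilon\}$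 compact for all $\epsilon>0$; $C_c(X)$: continuous with compact support; $+$ means nonnegative. Quasi-integral: for a finite deficient topological measure $\mu$ and $f\in C_0(X)$ with $f(X)\subseteq[a,b]$, $\int_X f\,d\mu=\int_a^b\mu(f^{-1}((t,\infty)))\,dt+a\,\mu(X)$. Weak topology: the coarsest making $\mu\mapsto\int_X f\,d\mu$ continuous for all $f\in C_0^+(X)$. A (deficient) topological measure is representable if it is in the closed convex hull (weak topology) of the simple (deficient) topological measures. For a representable topological measure $\mu$, $D^\mu=\bigcap\{K^\sharp:\mu(K)=1,\ K\in\mathscr{K}(X)\}\subseteq X^\sharp$; for a representable deficient topological measure $\mu$, $D^\mu=\bigcap\{K^\flat:\mu(K)=1,\ K\in\mathscr{K}(X)\}\subseteq X^\flat$. $Lip_s(X,d)=\{f\in C(X):|f(x)-f(y)|\le s\,d(x,y)\ \forall x,y\}$. For finite topological measures, $d_{KR}(\mu,\nu)=\sup\{|\int_X f\,d\mu-\int_X f\,d\nu|:f\in Lip_1(X,d)\cap C_c(X)\}$; for finite deficient topological measures the supremum is over nonnegative such $f$. Contractions on $X^\sharp$ and $X^\flat$ are with respect to $d_{KR}$. An image transformation on $X$ is a map $q:\mathscr{O}(X)\cup\mathscr{K}(X)\to\mathscr{O}(X)\cup\mathscr{K}(X)$ such that: $q$ takes open sets to open sets and compact sets to compact sets; $q(U)=\bigcup\{q(K):K\subseteq U,K\in\mathscr{K}(X)\}$ for open $U$; $q(K)=\bigcap\{q(U):K\subseteq U,U\in\mathscr{O}(X)\}$ for compact $K$; and $q(A\sqcup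 B)=q(A)\sqcup q(B)$ whenever $A,B,A\sqcup B\in\mathscr{O}(X)\cup\mathscr{K}(X)$. If the last property is required only for compact $A,B$, $q$ is a d-image transformation. Adjoint: $(q^*\nu)(A)=\nu(q(A))$ for $A$ open or compact (extended to closed sets by (TM3)). Corresponding quasi-homomorphism (respectively, conic quasi-homomorphism): $\theta(f)(y)=\int_X f\,d(q^*\delta_y)$, $\delta_y$ the point mass at $y$. For $0<s<1$, $q$ has contractivity factor $s$ if $\theta(Lip_1(X,d)\cap C_c(X))\subseteq Lip_s(X,d)\cap C_c(X)$ (image transformation), respectively $\theta(Lip_1(X,d)\cap C_c^+(X))\subseteq Lip_s(X,d)\cap C_c^+(X)$ (d-image transformation). In the finite case $S$ and $M$ are the corresponding finite sums. The attractor $A$ is the unique fixed point of $W$ among nonempty closed subsets of $X^\sharp$ (respectively, $X^\flat$), i.e. $W(A)=\bigcup_{i=1}^n q_i^*(A)=A$; it is the attractor of the iterated function system $\{X^\sharp,q_1^*,\dots,q_n^*\}$ (respectively, $\{X^\flat,q_1^*,\dots,q_n^*\}$). $\operatorname{supp} m_0$ is the complement of the largest open set of $m_0$-measure $0$.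
   Formalization: (2) is proved assuming μ_0(X)=1 (needed: m_0∘Λ has total mass 1, while μ_0=0 can occur for noncompact X); (3) is asserted only for i with α_i>0, and the finite part (i)-(iii) assumes all α_i>0 (false for zero weights). *)

(* Defs.v *)
From HB Require Import structures.
From mathcomp Require Import all_boot all_order all_algebra.
From mathcomp Require Import all_classical all_reals all_analysis.

Set Implicit Arguments.
Unset Strict Implicit.
Unset Printing Implicit Defensive.

Import Order.TTheory GRing.Theory Num.Theory.
Import numFieldNormedType.Exports.

Local Open Scope classical_set_scope.
Local Open Scope ring_scope.
Local Open Scope ereal_scope.

(* Nonempty metric spaces: the library's measurable types are pointed, and the
   point of X makes the spaces of simple measures below pointed. *)
#[short(type="pmetricType")]
HB.structure Definition PointedMetric (R : numDomainType) :=
  {T of Pointed T & Metric R T}.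

(* A boolean dfc selects one of two parallel theories throughout:
   dfc = false: topological measures, image transformations, X^sharp;
   dfc = true:  deficient topological measures, d-image transformations,
                X^flat. *)

Section TopologicalMeasures.
Context {R : realType} {X : pmetricType R}.
Implicit Types (mu nu : set X -> \bar R) (f : X -> R) (q : set X -> set X).

(* The sets on which disjoint additivity is imposed. *)
Definition additivity_class (dfc : bool) : set (set X) :=
  if dfc then [set A | compact A] else [set A | open A \/ compact A].

(* mu is meaningful on the open and the closed sets only; it is given the value
   0 on all other sets, so that equality of such functions is equality of
   (deficient) topological measures. *)
Record topological_measure (dfc : bool) mu : Prop := TopologicalMeasure {
  tm_ge0 : forall A, 0 <= mu A ;
  tm_junk : forall A, ~ (open A \/ closed A) -> mu A = 0 ;
  tm_proper : exists2 A, open A \/ closed A & mu A != +oo ;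
  tm_additive : forall A B,
    additivity_class dfc A -> additivity_class dfc B ->
    additivity_class dfc (A `|` B) -> A `&` B = set0 ->
    mu (A `|` B) = mu A + mu B ;
  tm_open : forall U, open U ->
    mu U = ereal_sup [set mu K | K in [set K | compact K /\ K `<=` U]] ;
  tm_closed : forall F, closed F ->
    mu F = ereal_inf [set mu U | U in [set U | open U /\ F `<=` U]] }.

(* Requiring mu setT = 1 excludes the zero measure. *)
Record simple_tm (dfc : bool) mu : Prop := SimpleTM {
  simple_tm_tm : topological_measure dfc mu ;
  simple_tm_01 : forall A, open A \/ closed A -> mu A = 0 \/ mu A = 1 ;
  simple_tm_norm : mu setT = 1 }.

Definition uniformly_bounded (MM : set (set X -> \bar R)) :=
  exists2 L : R, (0 < L)%R & forall mu, MM mu -> mu setT <= L%:E.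

(* Quasi-integral \int_a^b mu(f^{-1}(]t,oo[)) dt + a mu(X), for the least
   interval [a, b] that contains the range of f. *)
Definition qint f mu : R :=
  let a := inf (range f) in
  let b := sup (range f) in
  (fine (\int[lebesgue_measure]_(t in `[a, b]) mu (f @^-1` [set u | (t < u)%R]))
   + a * fine (mu setT))%R.

Definition C0 : set (X -> R) :=
  [set f | continuous f /\
    forall e : R, (0 < e)%R -> compact [set x | (e <= `|f x|)%R]].

Definition C0plus : set (X -> R) := [set f | C0 f /\ forall x, (0 <= f x)%R].

Definition Cc : set (X -> R) :=
  [set f | continuous f /\ compact (closure [set x | f x != 0%R])].

Definition Lip (s : R) : set (X -> R) :=
  [set f | continuous f /\
    forall x y, (`|f x - f y| <= s * mdist x y)%R].

(* Lip_s /\ C_c, restricted to nonnegative functions in the deficient case. *)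
Definition test_fun (dfc : bool) (s : R) : set (X -> R) :=
  [set f | Lip s f /\ Cc f /\ (dfc -> forall x, (0 <= f x)%R)].

Definition dKR (dfc : bool) mu nu : \bar R :=
  ereal_sup [set `|qint f mu - qint f nu|%R%:E | f in test_fun dfc 1].

(* A function given on open and compact sets, extended to closed sets by outer
   regularity (and by 0 to the remaining sets). *)
Definition extend_oc (phi : set X -> \bar R) : set X -> \bar R := fun A =>
  if `[< open A \/ compact A >] then phi A
  else if `[< closed A >] then
    ereal_inf [set phi U | U in [set U | open U /\ A `<=` U]]
  else 0.

Record image_transformation (dfc : bool) q : Prop := ImageTransformation {
  it_open : forall U, open U -> open (q U) ;
  it_compact : forall K, compact K -> compact (q K) ;
  it_bigcup : forall U, open U ->
    q U = \bigcup_(K in [set K | compact K /\ K `<=` U]) q K ;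
  it_bigcap : forall K, compact K ->
    q K = \bigcap_(U in [set U | open U /\ K `<=` U]) q U ;
  it_disjoint : forall A B,
    additivity_class dfc A -> additivity_class dfc B ->
    additivity_class dfc (A `|` B) -> A `&` B = set0 ->
    q (A `|` B) = q A `|` q B /\ q A `&` q B = set0 }.

Definition adjoint q nu : set X -> \bar R := extend_oc (fun A => nu (q A)).

Definition point_mass (y : X) : set X -> \bar R :=
  fun A => if `[< open A \/ closed A >] then (\1_A y)%:E else 0.

(* The (conic) quasi-homomorphism theta of an image transformation q. *)
Definition quasi_hom q f : X -> R := fun y => qint f (adjoint q (point_mass y)).

Definition contractivity_factor (dfc : bool) q (s : R) :=
  (0 < s < 1)%R /\
  forall f, test_fun dfc 1 f -> test_fun dfc s (quasi_hom q f).

Lemma point_mass_simple (dfc : bool) (y : X) : simple_tm dfc (point_mass y).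
Proof.
have clK (K : set X) : compact K -> closed K.
  by apply: compact_closed; exact: metric_hausdorff.
have cl1 : closed [set y] by apply: clK; exact: compact_set1.
have pmE A : open A \/ closed A -> point_mass y A = (\1_A y)%:E.
  by move=> /asboolP h; rewrite /point_mass h.
have pm0 A : 0 <= point_mass y A.
  by rewrite /point_mass; case: ifP => // _; rewrite lee_fin indicE.
have pm1 A : point_mass y A <= 1.
  rewrite /point_mass; case: ifP => // _; rewrite lee_fin indicE.
  by case: (y \in A).
have pmT : point_mass y setT = 1.
  by rewrite pmE ?indicE ?in_setT//; left; exact: openT.
have oc A : additivity_class dfc A -> open A \/ closed A.
  rewrite /additivity_class; case: dfc => /= [/clK|[|/clK]]; tauto.
split=> //.
- split=> //.
  + by move=> A h; rewrite /point_mass asboolF.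
  + by exists setT; [left; exact: openT|rewrite pmT].
  + move=> A B /oc hA /oc hB /oc hAB AB0; rewrite !pmE// -EFinD; congr (_%:E).
    rewrite !indicE in_setU.
    case: (boolP (y \in A)) => yA; case: (boolP (y \in B)) => yB//=.
    * move: yA yB; rewrite !inE => yA yB.
      by have : (A `&` B) y by []; rewrite AB0.
    * by rewrite addr0.
    * by rewrite add0r.
    * by rewrite addr0.
  + move=> U oU; apply/eqP; rewrite eq_le; apply/andP; split; last first.
      apply: ge_ereal_sup => _ [K [/clK cK KU] <-].
      rewrite !pmE; [|by left|by right]; rewrite lee_fin !indicE.
      case: (boolP (y \in K)) => // /set_mem yK.
      by rewrite mem_set//; exact: KU.
    case: (pselect (U y)) => Uy.
      apply: le_trans (pm1 _) _; apply: ereal_sup_ubound.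
      exists [set y]; last by rewrite pmE ?indicE ?mem_set//; right.
      by split; [exact: compact_set1|move=> _ ->].
    apply: (@le_trans _ _ 0).
      by rewrite pmE; [rewrite indicE memNset|left].
    apply: le_trans (pm0 set0) _; apply: ereal_sup_ubound.
    by exists set0 => //; split; [exact: compact0|exact: sub0set].
  + move=> F cF; apply/eqP; rewrite eq_le; apply/andP; split.
      apply: le_ereal_inf_tmp => _ [U [oU FU] <-].
      rewrite !pmE; [|by left|by right]; rewrite lee_fin !indicE.
      case: (boolP (y \in F)) => // /set_mem yF.
      by rewrite mem_set//; exact: FU.
    case: (pselect (F y)) => Fy.
      rewrite [leRHS]pmE; last by right.
      rewrite indicE mem_set//; apply: le_trans (pm1 setT).
      apply: ereal_inf_lbound; exists setT => //.
      by split=> //; exact: openT.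
    apply: (@le_trans _ _ 0); last exact: pm0.
    apply: ereal_inf_lbound; exists (~` [set y]).
      by split; [exact: closed_openC|move=> x Fx xy; apply: Fy; rewrite -xy].
    rewrite pmE; last by left; exact: closed_openC.
    by rewrite indicE memNset// => /(_ erefl).
- move=> A hA; rewrite pmE// indicE.
  by case: (y \in A); [right|left].
Qed.

End TopologicalMeasures.

Section SimpleSpace.
Context {R : realType}.

(* X^sharp (dfc = false) and X^flat (dfc = true). *)
Record sharp (X : pmetricType R) (dfc : bool) := Sharp {
  sharp_val :> set X -> \bar R ;
  sharpP : simple_tm dfc sharp_val }.

Context {X : pmetricType R} {dfc : bool}.

HB.instance Definition _ := gen_eqMixin (sharp X dfc).
HB.instance Definition _ := gen_choiceMixin (sharp X dfc).
HB.instance Definition _ := isPointed.Build (sharp X dfc)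
  (Sharp (point_mass_simple dfc (@point X))).

(* The topology of X^sharp and X^flat is that of dKR. *)
Definition sharp_ball (mu : sharp X dfc) (e : R) : set (sharp X dfc) :=
  [set nu : sharp X dfc | dKR dfc mu nu < e%:E].

Let sharp_ent : set_system (sharp X dfc * sharp X dfc) :=
  entourage_ sharp_ball.

Let sharp_nbhs (mu : sharp X dfc) : set_system (sharp X dfc) :=
  nbhs_ sharp_ent mu.

Let sharp_nbhsE : sharp_nbhs = nbhs_ sharp_ent. Proof. by []. Qed.

Let sharp_entE : sharp_ent = entourage_ sharp_ball. Proof. by []. Qed.

HB.instance Definition _ := hasNbhs.Build (sharp X dfc) sharp_nbhs.

Let sharp_ball_center (mu : sharp X dfc) (e : R) :
  (0 < e)%R -> sharp_ball mu e mu.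
Proof.
move=> e0; rewrite /sharp_ball/=; apply: (@le_lt_trans _ _ 0).
  by apply: ge_ereal_sup => _ [f _ <-]; rewrite subrr normr0.
by rewrite lte_fin.
Qed.

Let sharp_ball_sym (mu nu : sharp X dfc) (e : R) :
  sharp_ball mu e nu -> sharp_ball nu e mu.
Proof.
rewrite /sharp_ball/= /dKR; congr (ereal_sup _ < _).
by apply: eq_imagel => f _; rewrite distrC.
Qed.

Let sharp_ball_triangle (mu nu la : sharp X dfc) (e1 e2 : R) :
  sharp_ball mu e1 nu -> sharp_ball nu e2 la -> sharp_ball mu (e1 + e2) la.
Proof.
rewrite /sharp_ball/= => h1 h2; rewrite EFinD.
apply: le_lt_trans (lteD h1 h2).
apply: ge_ereal_sup => _ [f hf <-].
apply: (@le_trans _ _ (`|qint f mu - qint f nu|%R%:E +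
                       `|qint f nu - qint f la|%R%:E)).
  rewrite -EFinD lee_fin.
  by rewrite (le_trans _ (ler_normD _ _))// addrA subrK.
by apply: leeD; apply: ereal_sup_ubound; exists f.
Qed.

HB.instance Definition _ := @Nbhs_isPseudoMetric.Build R (sharp X dfc)
  sharp_ent sharp_nbhsE sharp_ball sharp_ball_center sharp_ball_sym
  sharp_ball_triangle sharp_entE.

End SimpleSpace.

Notation borel_sharp X dfc :=
  (g_sigma_algebraType (@open (sharp X dfc))).

Section Representable.
Context {R : realType} {X : pmetricType R}.
Implicit Types (mu : set X -> \bar R).

Definition simple_convex_hull (dfc : bool) : set (set X -> \bar R) :=
  [set mu | exists n (c : 'I_n -> R) (nu : 'I_n -> sharp X dfc),
     [/\ forall i, (0 <= c i)%R, (\sum_i c i)%R = 1%R &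
         mu = fun A => \sum_i (c i)%:E * nu i A]].

(* Map whose initial topology, for pointwise convergence on the codomain, is
   the coarsest one that makes mu |-> qint f mu continuous for each f in
   C_0^+. *)
Definition qint_family mu : {ptws set_type (@C0plus R X) -> R} :=
  fun f => qint (set_val f) mu.

(* The weak topology is put on all set functions; its trace on the finite
   (deficient) topological measures is their weak topology. *)
Definition representable (dfc : bool) mu :=
  topological_measure dfc mu /\
  closure (simple_convex_hull dfc : set (initial_topology qint_family)) mu.

End Representable.

Section MarkovOperators.
Context {R : realType} {X : pmetricType R} {dfc : bool}.
Implicit Types (mu : set X -> \bar R) (q : set X -> set X).

Definition Lambda (E : set X) : set (sharp X dfc) :=
  [set nu : sharp X dfc | nu E = 1].

Definition comp_Lambda (m : set (sharp X dfc) -> \bar R) : set X -> \bar R :=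
  extend_oc (fun E => m (Lambda E)).

Definition Dset mu : set (sharp X dfc) :=
  \bigcap_(K in [set K | compact K /\ mu K = 1]) Lambda K.

(* Qi is q^* as a self-map of X^sharp or X^flat. *)
Definition is_adjoint q (Qi : sharp X dfc -> sharp X dfc) :=
  forall nu : sharp X dfc, Qi nu = adjoint q nu :> (set X -> \bar R).

Definition markov_tm (alpha : nat -> R) (q : nat -> set X -> set X) mu :
    set X -> \bar R :=
  fun A => \sum_(0 <= i <oo) (alpha i)%:E * adjoint (q i) mu A.

Definition markov_prob (alpha : nat -> R)
    (Q : nat -> sharp X dfc -> sharp X dfc) (m : set (sharp X dfc) -> \bar R) :
    set (sharp X dfc) -> \bar R :=
  fun B => \sum_(0 <= i <oo) (alpha i)%:E * m (Q i @^-1` B).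

Definition markov_tm_fin n (alpha : 'I_n -> R) (q : 'I_n -> set X -> set X) mu :
    set X -> \bar R :=
  fun A => \sum_(i < n) (alpha i)%:E * adjoint (q i) mu A.

Definition markov_prob_fin n (alpha : 'I_n -> R)
    (Q : 'I_n -> sharp X dfc -> sharp X dfc)
    (m : set (sharp X dfc) -> \bar R) : set (sharp X dfc) -> \bar R :=
  fun B => \sum_(i < n) (alpha i)%:E * m (Q i @^-1` B).

Definition unique_fixed_in (MM : set (set X -> \bar R))
    (S : (set X -> \bar R) -> (set X -> \bar R)) mu0 :=
  [/\ MM mu0, S mu0 = mu0 & forall mu, MM mu -> S mu = mu -> mu = mu0].

Definition unique_fixed_prob
    (M : (set (sharp X dfc) -> \bar R) -> (set (sharp X dfc) -> \bar R))
    (m0 : probability (borel_sharp X dfc) R) :=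
  let fixed (m : probability (borel_sharp X dfc) R) :=
    forall B : set (borel_sharp X dfc), measurable B -> M m B = m B in
  fixed m0 /\
  forall m, fixed m ->
    forall B : set (borel_sharp X dfc), measurable B -> m B = m0 B.

Definition hutchinson n (Q : 'I_n -> sharp X dfc -> sharp X dfc)
    (F : set (sharp X dfc)) : set (sharp X dfc) :=
  \bigcup_i (Q i @` F).

Definition is_attractor n (Q : 'I_n -> sharp X dfc -> sharp X dfc)
    (A : set (sharp X dfc)) :=
  let fixed F := [/\ closed F, F !=set0 & hutchinson Q F = F] in
  fixed A /\ forall F, fixed F -> F = A.

Definition supp_prob (m : set (sharp X dfc) -> \bar R) : set (sharp X dfc) :=
  ~` \bigcup_(O in [set O | open O /\ m O = 0]) O.

End MarkovOperators.

(* Main.v *)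
Require Import Defs.
From HB Require Import structures.
From mathcomp Require Import all_boot all_order all_algebra.
From mathcomp Require Import all_classical all_reals all_analysis.
From mathcomp Require Import ring lra.

Set Implicit Arguments.
Unset Strict Implicit.
Unset Printing Implicit Defensive.

Import Order.TTheory GRing.Theory Num.Theory.
Import numFieldNormedType.Exports.

Local Open Scope classical_set_scope.
Local Open Scope ring_scope.
Local Open Scope ereal_scope.

(* Write L m for the set function A |-> m {nu | nu A = 1}. The preimage of a
   superlevel set {t < theta f} under evaluation is q {t < f}, so q^* is a
   contraction for dKR and S (L m) = L (M m) on open and compact sets.

   Let mu0 be a fixed point of S of mass 1. Iterating S replaces a Lipschitz test
   function by functions with constants s^n; such a function is nearly constant
   on a ball that carries almost all of the mass. Hence mu0 and L m0 nearly agree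
   on superlevel sets, which gives mu0 U = L m0 U for open U up to passing to
   relatively compact open subsets of U. X need not be separable, but M m0 = m0
   forces m0 to be carried, up to any error, by finitely many balls of any given
   radius, so that m0 is continuous along directed families of open sets.

   For the attractor it suffices that supp m0 is fixed by W. A point nu of supp m0
   is a limit of values q_i^* nu_k with nu_k in supp m0, which is totally bounded.
   X^sharp and X^flat need not be complete, but nu V = 1 for some relatively
   compact open V, hence eventually nu_k (q_i (closure V)) = 1, and a Cauchy
   ultrafilter of measures with value 1 at a fixed compact set has a limit. *)

(** The identity with [comp_Lambda m0] cannot be had from uniqueness of the fixed point: the
    barycenter is not known to be a (deficient) topological measure, let alone a member of [MM], and
    quasi-integrals are not linear. So two invariant set functions are compared directly. Superlevel
    sets allow this: [q] sends [{u < f}] to [{u / s < g}], where [g] is the image of [f] divided by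
    [s] and again 1-Lipschitz. Each step thus divides the gap between two levels by [s], until the
    gap exceeds the diameter bound of a fixed ball. Mass 1 matters because the zero measure is
    invariant as well. Representability supplies [mu0 setT <= 1]: simple measures have mass 1 and
    [qint f] is weakly continuous. To serve both values of [dfc], arguments rely on additivity over
    compact sets where possible; mixed open and compact additivity enters for limits of topological
    measures, for test functions of negative integral, and for a simple [mu0]. *)

Section SetFunctions.
Context {R : realType} {X : pmetricType R} {dfc : bool} {mu : set X -> \bar R}.
Hypothesis tmu : topological_measure dfc mu.

Lemma metric_compact_closed (K : set X) : compact K -> closed K.
Proof. by apply: compact_closed; exact: metric_hausdorff. Qed.

Lemma additivity_compact (K : set X) : compact K -> additivity_class dfc K.
Proof. by move=> cK; rewrite /additivity_class; case: (dfc) => //=; right. Qed.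

(** Monotonicity is not an axiom but follows from regularity: inner for two open sets, outer for a
    closed set in an open one, and outer again to reduce a closed larger set to open ones. *)
Lemma tm_le (A B : set X) : open A \/ closed A -> open B \/ closed B ->
  A `<=` B -> mu A <= mu B.
Proof.
have oo U V : open U -> open V -> U `<=` V -> mu U <= mu V.
  move=> oU oV UV; rewrite (tm_open tmu oU) (tm_open tmu oV).
  apply: ge_ereal_sup => _ [K [cK KU] <-]; apply: ereal_sup_ubound.
  by exists K => //; split=> //; exact: subset_trans UV.
have co F V : closed F -> open V -> F `<=` V -> mu F <= mu V.
  move=> cF oV FV; rewrite (tm_closed tmu cF).
  by apply: ereal_inf_lbound; exists V.
move=> hA [oB|cB] AB; first by case: hA => hA; [exact: oo|exact: co].
rewrite (tm_closed tmu cB); apply: le_ereal_inf_tmp => _ [U [oU BU] <-].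
have AU := subset_trans AB BU.
by case: hA => hA; [exact: oo|exact: co].
Qed.

Lemma tm_compact_superadd (K L : set X) (C : set X) : compact K -> compact L ->
  K `&` L = set0 -> open C \/ closed C -> K `|` L `<=` C ->
  mu K + mu L <= mu C.
Proof.
move=> cK cL KL hC KLC; have cKL := compactU cK cL.
rewrite -(tm_additive tmu) //; try exact: additivity_compact.
by apply: tm_le => //; right; exact: metric_compact_closed.
Qed.

Lemma tm_inner (U : set X) (r : \bar R) : open U ->
  (forall K, compact K -> K `<=` U -> mu K <= r) -> mu U <= r.
Proof.
move=> oU h; rewrite (tm_open tmu oU).
by apply: ge_ereal_sup => _ [K [cK KU] <-]; exact: h.
Qed.

Lemma tm_inner_lt (U : set X) (r : \bar R) : open U -> r < mu U ->
  exists K, [/\ compact K, K `<=` U & r < mu K].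
Proof.
move=> oU rU; apply/not_existsP => h; have : mu U <= r.
  apply: tm_inner => // K cK KU; rewrite leNgt; apply/negP => rK.
  exact: (h K).
by rewrite leNgt rU.
Qed.

Lemma tm_outer_lt (F : set X) (r : \bar R) : closed F -> mu F < r ->
  exists U, [/\ open U, F `<=` U & mu U < r].
Proof.
move=> cF; rewrite (tm_closed tmu cF) => /ereal_inf_lt [_ [U [oU FU] <-] Ur].
by exists U.
Qed.

End SetFunctions.

(** * Bump functions on locally compact metric spaces *)

Section MetricFacts.
Context {R : realType} {X : pmetricType R}.
Local Open Scope ring_scope.

Lemma open_ball_metric (x : X) (r : R) : open (ball x r).
Proof.
rewrite openE => y; rewrite ballEmdist /= => xy.
apply/nbhs_ballP; exists (r - mdist x y); first by rewrite /= subr_gt0.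
move=> z; rewrite !ballEmdist /= ltrBrDl; apply: le_lt_trans.
exact: metric_triangle.
Qed.

Lemma compact_sub_ball (x : X) (K : set X) : compact K ->
  exists2 r : R, 0 < r & K `<=` ball x r.
Proof.
move=> /compact_near_coveringP cK.
have := cK R (pinfty_nbhs R) (fun r y => ball x r y) _.
case/(_ _) => [y Ky|r [rr h]].
  exists (ball y 1, [set r | mdist x y + 1 < r]) => /=.
    by split; [exact: nbhsx_ballx|apply: nbhs_pinfty_gt; rewrite num_real].
  move=> [z r] /=; rewrite !ballEmdist /= => -[yz]; apply: lt_trans.
  by apply: le_lt_trans (metric_triangle x y z) _; rewrite ltrD2l.
exists (`|r| + 1); first by rewrite ltr_wpDl.
by apply: (h (`|r| + 1)); rewrite (le_lt_trans (ler_norm r))// ltrDl.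
Qed.

Lemma compact_uniform_ball (K U : set X) : compact K -> open U -> K `<=` U ->
  exists2 e : R, 0 < e & forall k y, K k -> mdist k y < e -> U y.
Proof.
move=> /compact_near_coveringP cK oU KU.
have := cK R (0^'+) (fun e y => ball y e `<=` U) _.
case/(_ _) => [x Kx|].
  have /nbhs_ballP[e /= e0 xeU] : nbhs x U.
    by apply: open_nbhs_nbhs; split=> //; exact: KU.
  exists (ball x (e / 2), [set d : R | d < e / 2]) => /=.
    split; first by apply: nbhsx_ballx; rewrite divr_gt0.
    by apply: nbhs_right_lt; rewrite divr_gt0.
  move=> [y d] /= [xy de] z yz; apply: xeU.
  apply: (@ball_split _ _ y) => //; apply: le_ball yz; exact: ltW.
move=> e /= e0 h.
exists (e / 2); first by rewrite divr_gt0.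
move=> k y Kk ky; apply: (h (e / 2) _ _ k) => //=.
- by rewrite sub0r normrN gtr0_norm ?divr_gt0// ltr_pdivrMr// ltr_pMr// ltr1n.
- by rewrite divr_gt0.
- by rewrite ballEmdist.
Qed.

Lemma compact_subset_interior (K : set X) : locally_compact [set: X] ->
  compact K -> exists2 C, compact C & K `<=` C^°.
Proof.
move=> lc /compact_near_coveringP cK.
(* The covering criterion is run along the filter of all sufficiently large compact sets, which are
   directed by union. *)
pose F : set_system (set X) :=
  filter_from [set C : set X | compact C] (fun C => [set D | compact D /\ C `<=` D]).
have FF : Filter F.
  apply: filter_from_filter; first by exists set0; exact: compact0.
  move=> A B cA cB; exists (A `|` B); first exact: compactU.
  move=> D [cD]; rewrite subUset => -[AD BD]; by split.
have : \near F, K `<=` F^°.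
  apply: (cK _ F (fun C x => C^° x)) => x Kx.
  have [] := lc x I; rewrite /= => V; rewrite withinET => xV [cV clV].
  exists (V^°, [set D | compact D /\ V `<=` D]).
    split => /=; last by exists V.
    exact: nbhs_interior xV.
  by move=> [y D] /= [Vy [cD VD]]; have := interiorS VD Vy.
by move=> [C cC h]; exists C => //; exact: (h C (conj cC (@subset_refl _ C))).
Qed.

Lemma compact_open_between (K U : set X) : locally_compact [set: X] ->
  compact K -> open U -> K `<=` U ->
  exists V, [/\ open V, K `<=` V, closure V `<=` U & compact (closure V)].
Proof.
move=> lc cK oU KU; have [C cC KC] := compact_subset_interior lc cK.
have oUC : open (U `&` C^°) by apply: openI => //; exact: open_interior.
have [e e0 h] := compact_uniform_ball cK oUC (fun x Kx => conj (KU x Kx) (KC x Kx)).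
have e20 : 0 < e / 2 by rewrite divr_gt0.
pose V := \bigcup_(k in K) ball k (e / 2).
have VUC : closure V `<=` U `&` C^°.
  move=> x /(_ (ball x (e / 2)) (nbhsx_ballx _ _ e20)) [y [[k Kk ky] xy]].
  apply: (h k) => //; have : ball k e x.
    by apply: (@ball_splitl _ _ y).
  by rewrite ballEmdist.
exists V; split.
- by apply: bigcup_open => k _; exact: open_ball_metric.
- by move=> k Kk; exists k => //; exact: ballxx.
- by move=> x /VUC[].
- apply: subclosed_compact cC _; first exact: closed_closure.
  by move=> x /VUC[_]; exact: interior_subset.
Qed.

Lemma lipschitz_continuous (f : X -> R) (s : R) :
  (forall x y, `|f x - f y| <= s * mdist x y) -> continuous f.
Proof.
move=> fs x; apply/cvgrPdist_lt => e e0.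
have s1 : 0 < `|s| + 1 by rewrite ltr_wpDl.
near=> y; apply: le_lt_trans (fs x y) _.
have : mdist x y < e / (`|s| + 1).
  near: y; apply/nbhs_ballP; exists (e / (`|s| + 1)); first by rewrite /= divr_gt0.
  by move=> y; rewrite ballEmdist.
rewrite ltr_pdivlMr// => h; apply: le_lt_trans h.
rewrite mulrC ler_wpM2l ?mdist_ge0//.
by rewrite (le_trans (ler_norm s))// lerDl.
Unshelve. all: by end_near. Qed.

(** Take [max 0 (e - d(x, K))]. Its height [c] cannot be normalised, since the Lipschitz constant
    has to be 1; nonnegativity makes it a test function in both theories. *)
Lemma bump_function (K U : set X) : locally_compact [set: X] ->
  compact K -> open U -> K `<=` U ->
  exists f, exists c : R, [/\ 0 < c, test_fun true 1 f, forall x, 0 <= f x <= c,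
    forall x, K x -> f x = c & forall x, 0 < f x -> U x].
Proof.
move=> lc cK oU KU.
(* The distance to the empty set would be an infimum over no points. *)
have [->|/set0P K0] := eqVneq K set0.
  exists (fun=> 0), 1; split=> //; last 2 first.
  - by move=> x; rewrite lexx ler01.
  - by move=> x; rewrite ltxx.
  split; first split.
  - by move=> x; exact: cvg_cst.
  - by move=> x y; rewrite subrr normr0 mul1r mdist_ge0.
  split=> //; split; first by move=> x; exact: cvg_cst.
  rewrite (_ : [set _ | _] = set0) ?closure0; first exact: compact0.
  by apply/seteqP; split=> x //=; rewrite eqxx.
have [V [oV KV VU cV]] := compact_open_between lc cK oU KU.
have [e e0 h] := compact_uniform_ball cK oV KV.
pose D x := [set mdist x k | k in K].
pose dK x := inf (D x).
have D0 x : D x !=set0 by case: K0 => k Kk; exists (mdist x k), k.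
have lbD x : has_lbound (D x) by exists 0 => _ [k _ <-]; exact: mdist_ge0.
have dKle x k : K k -> dK x <= mdist x k.
  by move=> Kk; apply: ge_inf => //; exists k.
have dK0 x : 0 <= dK x.
  by apply: lb_le_inf => // _ [k _ <-]; exact: mdist_ge0.
have dKD x y : dK x <= mdist x y + dK y.
  rewrite -lerBlDl; apply: lb_le_inf => // _ [k Kk <-].
  rewrite lerBlDl; apply: le_trans (dKle x k Kk) _; exact: metric_triangle.
have dKlt x r : dK x < r -> exists2 k, K k & mdist k x < r.
  by move=> /(inf_lt (D0 x)) [_ [k Kk <-]] kr; exists k => //; rewrite metric_sym.
have dKK x : K x -> dK x = 0.
  by move=> Kx; apply/eqP; rewrite eq_le dK0 andbT -[leRHS](mdistxx x) dKle.
pose f x := Num.max 0 (e - dK x).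
have fV x : 0 < f x -> V x.
  rewrite /f lt_max ltxx/= subr_gt0 => /dKlt[k Kk]; exact: h.
have f1 x y : `|f x - f y| <= 1 * mdist x y.
  rewrite mul1r; have := dKD x y; have := dKD y x; rewrite (metric_sym y x) /f.
  have := mdist_ge0 x y.
  move: (mdist x y) (dK x) (dK y) => m a b *.
  by rewrite ler_norml; case: (leP 0 (e - a)); case: (leP 0 (e - b)) => ? ?; apply/andP; split; lra.
have fc := lipschitz_continuous f1.
have f0 x : 0 <= f x by rewrite /f le_max lexx.
exists f, e; split => //.
- split; first by split.
  split=> //; split=> //; apply: subclosed_compact cV _; first exact: closed_closure.
  apply: closure_subset => x /= fx0; apply: fV.
  by rewrite lt_neqAle eq_sym fx0 f0.
- by move=> x; rewrite f0 /f ge_max (ltW e0) lerBlDl lerDr dK0.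
- by move=> x /dKK; rewrite /f => ->; rewrite subr0 max_r// ltW.
- by move=> x /fV Vx; apply: VU; exact: subset_closure.
Qed.

End MetricFacts.

(** * Simple measures and the quasi-integral *)

Notation sup_level f t := (f @^-1` [set u | (t < u)%R]).

Section SimpleMeasures.
Context {R : realType} {X : pmetricType R} {dfc : bool}.
Implicit Types (nu : sharp X dfc) (f : X -> R).

Lemma sharp_tm nu : topological_measure dfc nu.
Proof. exact: simple_tm_tm (sharpP nu). Qed.

Lemma sharpT nu : nu setT = 1.
Proof. exact: simple_tm_norm (sharpP nu). Qed.

Lemma sharp_neq1 nu (A : set X) : open A \/ closed A ->
  nu A <> 1 -> nu A = 0.
Proof. by move=> /(simple_tm_01 (sharpP nu))[]. Qed.

Lemma sharp_le1 nu (A : set X) : open A \/ closed A -> nu A <= 1.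
Proof. by move=> /(simple_tm_01 (sharpP nu))[->|->]. Qed.

Lemma sharpS nu (A B : set X) : open A \/ closed A -> open B \/ closed B ->
  A `<=` B -> nu A = 1 -> nu B = 1.
Proof.
move=> hA hB AB A1; apply/eqP; rewrite eq_le sharp_le1//=.
by rewrite -A1; exact: (tm_le (sharp_tm nu)).
Qed.

Lemma sharp_inner nu (U : set X) : open U -> nu U = 1 ->
  exists K, [/\ compact K, K `<=` U & nu K = 1].
Proof.
move=> oU U1; have /(tm_inner_lt (sharp_tm nu) oU) : 0 < nu U by rewrite U1.
move=> [K [cK KU K0]]; exists K; split=> //.
have [K0'|//] := simple_tm_01 (sharpP nu) (or_intror (metric_compact_closed cK)).
by rewrite K0' ltxx in K0.
Qed.

Lemma sharp_outer nu (F : set X) : closed F -> nu F <> 1 ->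
  exists U, [/\ open U, F `<=` U & nu U <> 1].
Proof.
move=> cF /(sharp_neq1 (or_intror cF)) F0.
have /(tm_outer_lt (sharp_tm nu) cF) : nu F < 1 by rewrite F0.
move=> [U [oU FU U1]]; exists U; split=> // U1'.
by rewrite U1' ltxx in U1.
Qed.

(** Compact subsets of value 1 in [A] and in [B] would give the whole space mass at least 2. *)
Lemma sharp_disj nu (A B : set X) : open A \/ compact A -> open B \/ compact B ->
  A `&` B = set0 -> nu A = 1 -> nu B = 1 -> False.
Proof.
have inn C : open C \/ compact C -> nu C = 1 ->
    exists K, [/\ compact K, K `<=` C & nu K = 1].
  by move=> [oC C1|cC C1]; [exact: sharp_inner|exists C; split].
move=> hA hB AB /(inn _ hA)[K [cK KA K1]] /(inn _ hB)[L [cL LB L1]].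
have KL : K `&` L = set0.
  by rewrite -subset0 -AB => x [/KA ? /LB].

have := tm_compact_superadd (sharp_tm nu) cK cL KL (or_introl openT) (@subsetT _ _).
by rewrite K1 L1 sharpT -EFinD lee_fin gerDl ler10.
Qed.

Lemma sharp_set0 nu : nu set0 <> 1.
Proof.
by move=> h; apply: (@sharp_disj nu set0 set0) => //; rewrite ?set0I//; left; exact: open0.
Qed.

Lemma open_sup_level f t : continuous f -> open (sup_level f t).
Proof.
by move=> fc; apply: open_comp => [x _|]; [exact: fc|exact: open_gt].
Qed.

Lemma sharp_eq nu nu' : (forall U, open U -> nu U = 1 -> nu' U = 1) ->
  (forall U, open U -> nu' U = 1 -> nu U = 1) -> nu = nu'.
Proof.
move=> h1 h2; have hU U : open U -> nu U = nu' U.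
  move=> oU; have := simple_tm_01 (sharpP nu) (or_introl oU).
  have := simple_tm_01 (sharpP nu') (or_introl oU).
  move=> [e'|e'] [e|e]; rewrite e e'//.
  - by have := h1 _ oU e; rewrite e'.
  - by have := h2 _ oU e'; rewrite e.
have e : (nu : set X -> \bar R) = nu'.
  apply/funext => A; have [oA|nA] := pselect (open A); first exact: hU.
  have [cA|nA'] := pselect (closed A); last first.
    by rewrite (tm_junk (sharp_tm nu)) ?(tm_junk (sharp_tm nu'))// => -[].
  rewrite (tm_closed (sharp_tm nu) cA) (tm_closed (sharp_tm nu') cA).
  by congr ereal_inf; apply: eq_imagel => U [oU _]; exact: hU.
case: nu nu' e {h1 h2 hU} => [v p] [v' p'] /= e.
by rewrite e in p *; congr Sharp; exact: Prop_irrelevance.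
Qed.

(** For a 0-1 valued measure the integrand [t |-> nu {t < f}] is the indicator of a half-line, and
    the quasi-integral is its endpoint [p]. The value at the level [p] itself is left open. *)
Lemma qint_simple f nu : continuous f -> (exists M, forall x, (`|f x| <= M)%R) ->
  (forall t, (t < qint f nu)%R -> nu (sup_level f t) = 1) /\
  (forall t, nu (sup_level f t) = 1 -> (t <= qint f nu)%R).
Proof.
move=> fc [M fM].
have rf0 : range f !=set0 by exists (f point), point.
have lbf : has_lbound (range f).
  by exists (- M)%R => _ [x _ <-]; have := fM x; rewrite ler_norml => /andP[].
have ubf : has_ubound (range f).
  by exists M => _ [x _ <-]; have := fM x; rewrite ler_norml => /andP[].
pose a := inf (range f); pose b := sup (range f).
have oL t : open (sup_level f t) by exact: open_sup_level.
pose D := [set t | nu (sup_level f t) = 1].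
have Da t : (t < a)%R -> D t.
  move=> ta; rewrite /D/= (_ : sup_level f t = setT) ?sharpT//.
  apply/seteqP; split=> // x _ /=; apply: lt_le_trans ta _.
  by apply: ge_inf => //; exists x.
have Db t : D t -> (t < b)%R.
  rewrite ltNge => Dt; apply/negP => bt; apply: (@sharp_set0 nu).
  rewrite -Dt; congr (nu _); apply/seteqP; split=> // x /=.
  by rewrite ltNge (le_trans _ bt)//; apply: ub_le_sup => //; exists x.
have Ddown t t' : (t' <= t)%R -> D t -> D t'.
  by move=> tt'; apply: sharpS; [left|left|move=> x /=; exact: le_lt_trans].
have D0 : D !=set0 by exists (a - 1)%R; apply: Da; rewrite gtrBl.
have ubD : has_ubound D by exists b => t /Db /ltW.
pose p := sup D.
have ltp t : (t < p)%R -> D t.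
  by move=> /(sup_gt D0) [t' Dt'] tt'; apply: Ddown Dt'; exact: ltW.
have lep t : D t -> (t <= p)%R by move=> Dt; exact: ub_le_sup.
have ap : (a <= p)%R.
  by rewrite leNgt; apply/negP => /midf_lt [h1 /Da /lep]; rewrite leNgt h1.
have pb : (p <= b)%R by apply: ge_sup => // t /Db /ltW.
suff -> : qint f nu = p by [].
rewrite /qint -/a -/b sharpT /= mulr1.
(* The half-line contains its endpoint exactly when the level [p] has value 1. *)
pose B : set R := [set` Interval -oo%O (if `[< D p >] then BRight p else BLeft p)].
have nuE t : nu (sup_level f t) = (\1_B t)%:E.
  rewrite indicE; have [tB|tB] := pselect (B t).
  - rewrite mem_set//; move: tB; rewrite /B; case: asboolP => Dp /=; rewrite in_itv/= => h.
      exact: (Ddown _ _ h Dp).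
    exact: ltp.
  - rewrite memNset//; apply: (sharp_neq1 (or_introl (oL t))) => Dt; apply: tB.
    rewrite /B; case: asboolP => Dp /=; rewrite in_itv/=; first exact: lep.
    by rewrite lt_neqAle lep// andbT; apply/eqP => tp; apply: Dp; rewrite -tp.
under eq_integral => t _ do rewrite nuE.
rewrite integral_indic//; last exact: measurable_itv.
rewrite (_ : B `&` _ = [set` Interval (BLeft a) (if `[< D p >] then BRight p else BLeft p)]).
  rewrite [X in fine X](_ : _ = (p - a)%:E) /= ?subrK//.
  have := @lebesgue_measure_itv R (Interval (BLeft a) (if `[< D p >] then BRight p else BLeft p)).
  move=> e; apply: eq_trans e _.
  by case: asboolP => Dp /=; rewrite lte_fin; case: ltP => /= h; congr EFin; lra.
rewrite /B; case: asboolP => Dp; apply/seteqP; split => t /=; rewrite !in_itv /=.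
- by move=> [-> /andP[->]].
- by move=> /andP[-> tp]; rewrite tp (le_trans tp).
- by move=> [-> /andP[->]].
- by move=> /andP[-> tp]; rewrite tp (le_trans (ltW tp)).
Qed.

(** Quasi-integrals of simple measures are thresholds; if the two sides differed, a level strictly
    between them would violate the equivalence. *)
Lemma qint_simple_eq f g nu nu' (c : R) : continuous f -> continuous g ->
  (exists M, forall x, (`|f x| <= M)%R) -> (exists M, forall x, (`|g x| <= M)%R) ->
  (0 < c)%R ->
  (forall t, nu (sup_level f (c * t)) = 1 <-> nu' (sup_level g t) = 1) ->
  qint f nu = (c * qint g nu')%R.
Proof.
move=> fc gc fM gM c0 h.
have [f1 f2] := qint_simple nu fc fM; have [g1 g2] := qint_simple nu' gc gM.
apply/eqP; rewrite eq_le; apply/andP; split; rewrite leNgt; apply/negP.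
- move=> /midf_lt; set t := (_ / 2)%R => -[/[swap] /f1 h1].
  have {}h1 : nu' (sup_level g (t / c)) = 1.
    by apply/h; rewrite mulrC divfK// gt_eqF.
  have := g2 _ h1; rewrite ler_pdivrMr// mulrC => h2 /lt_le_trans/(_ h2).
  by rewrite ltxx.
- rewrite mulrC -ltr_pdivrMr// => /midf_lt; set t := (_ / 2)%R => -[/[swap]].
  move=> /g1/h/f2; rewrite ltr_pdivrMr// mulrC => h2 /lt_le_trans/(_ h2).
  by rewrite ltxx.
Qed.

Lemma Cc_bounded f : Cc f -> exists M, forall x, (`|f x| <= M)%R.
Proof.
move=> [fc cf].
have /compact_bounded [M [_ /(_ (M + 1)%R)]] :
    compact (f @` closure [set x | f x != 0%R]).
  by apply: continuous_compact => //; exact: continuous_subspaceT.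
rewrite ltrDl ltr01 => /(_ isT) h; exists (Num.max 0 (M + 1))%R => x.
rewrite le_max; have [->|fx0] := eqVneq (f x) 0%R; first by rewrite normr0 lexx.
by apply/orP; right; apply: h; exists x => //; exact: subset_closure.
Qed.

Lemma test_fun_Cc b s f : test_fun b s f -> continuous f /\
  exists M, forall x, (`|f x| <= M)%R.
Proof. by move=> [[? _] [/Cc_bounded]]. Qed.

End SimpleMeasures.

(** * The spaces of simple measures *)

Section SharpTopology.
Context {R : realType} {X : pmetricType R} {dfc : bool}.
Hypothesis lcX : locally_compact [set: X].
Implicit Types (nu : sharp X dfc) (f : X -> R).

Lemma sharp_ballE nu e : ball nu e = [set nu' | dKR dfc nu nu' < e%:E].
Proof. by []. Qed.

Lemma test_fun_nneg f s : test_fun true s f -> test_fun dfc s f.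
Proof. by move=> [? [? f0]]; split=> //; split=> // _; exact: f0. Qed.

Lemma dKR_ge nu nu' f : test_fun dfc 1 f ->
  `|qint f nu - qint f nu'|%R%:E <= dKR dfc nu nu'.
Proof. by move=> tf; apply: ereal_sup_ubound; exists f. Qed.

(** The supremum is not over the empty set, as the bump function of [set0] is a test function. *)
Lemma dKR_ge0 nu nu' : 0 <= dKR dfc nu nu'.
Proof.
have [f [c [_ /test_fun_nneg tf _ _ _]]] :=
  bump_function lcX compact0 open0 (@subset_refl X set0).
by apply: le_trans (dKR_ge nu nu' tf); rewrite lee_fin normr_ge0.
Qed.

Lemma ball_qint nu nu' e f : test_fun dfc 1 f -> ball nu e nu' ->
  (`|qint f nu - qint f nu'| < e)%R.
Proof.
rewrite sharp_ballE /= => tf; rewrite -lte_fin; apply: le_lt_trans.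
exact: dKR_ge.
Qed.

Lemma le_qint nu f (c : R) (A : set X) : continuous f ->
  (exists M, forall x, (`|f x| <= M)%R) -> open A \/ closed A -> nu A = 1 ->
  (forall x, A x -> (c <= f x)%R) -> (c <= qint f nu)%R.
Proof.
move=> fc fM hA A1 cf; apply/ler_addgt0Pr => e e0; rewrite -lerBlDr.
apply: (qint_simple nu fc fM).2; apply: sharpS A1 => //.
  by left; exact: open_sup_level.
by move=> x /cf /= h; rewrite (lt_le_trans _ h)// gtrBl.
Qed.

Lemma qint_le nu f (c : R) (A : set X) : continuous f ->
  (exists M, forall x, (`|f x| <= M)%R) -> open A \/ compact A -> nu A = 1 ->
  (forall x, A x -> (f x <= c)%R) -> (qint f nu <= c)%R.
Proof.
move=> fc fM hA A1 fA; rewrite leNgt; apply/negP => /(qint_simple nu fc fM).1 c1.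
apply: (sharp_disj hA _ _ A1 c1); first by left; exact: open_sup_level.
by rewrite -subset0 => x [/fA /=]; rewrite leNgt => /negP.
Qed.

(** A bump function of height [c] on a compact [K] with [nu K = 1] has integral at least [c]. A
    measure closer than [c] then integrates it to a positive number, hence has value 1 on [{0 < f}],
    which lies in [U]. *)
Lemma open_Lambda (U : set X) : open U -> open (Lambda U : set (sharp X dfc)).
Proof.
move=> oU; rewrite openE => nu /(sharp_inner oU)[K [cK KU K1]].
have [f [c [c0 tf f0c fK fU]]] := bump_function lcX cK oU KU.
have [fc fM] := test_fun_Cc tf.
have cf : (c <= qint f nu)%R.
  apply: le_qint K1 _ => //; first by right; exact: metric_compact_closed.
  by move=> x /fK ->.
apply/nbhs_ballP; exists c => //= nu' /(ball_qint (test_fun_nneg tf)).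
rewrite ltr_norml => /andP[_ h].
have /(qint_simple nu' fc fM).1 : (0 < qint f nu')%R by lra.
by apply: sharpS; [left; exact: open_sup_level|left|exact: fU].
Qed.

(** If [nu U] is not 1 for some neighbourhood [U] of [K], a bump function has integral at most 0 for
    [nu], but at least its height [c] for every measure in [Lambda K]. *)
Lemma closed_Lambda (K : set X) : compact K ->
  closed (Lambda K : set (sharp X dfc)).
Proof.
move=> cK; rewrite -openC openE => nu nuK.
have [U [oU KU nuU]] := sharp_outer (metric_compact_closed cK) nuK.
have [f [c [c0 tf f0c fK fU]]] := bump_function lcX cK oU KU.
have [fc fM] := test_fun_Cc tf.
have f0 : (qint f nu <= 0)%R.
  rewrite leNgt; apply/negP => /(qint_simple nu fc fM).1 h; apply: nuU.
  by apply: sharpS h; [left; exact: open_sup_level|left|exact: fU].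
apply/nbhs_ballP; exists c => //= nu' /(ball_qint (test_fun_nneg tf)).
rewrite ltr_norml => /andP[h _] nu'K.
have : (c <= qint f nu')%R.
  apply: le_qint nu'K _ => //; first by right; exact: metric_compact_closed.
  by move=> x /fK ->.
by move: h f0; lra.
Qed.

Lemma open_ball_sharp nu e : open (ball nu e).
Proof.
rewrite openE => nu'; rewrite sharp_ballE /= => h.
have fin : dKR dfc nu nu' \is a fin_num.
  by rewrite ge0_fin_numE ?dKR_ge0// (lt_trans h)// ltry.
move: h; rewrite -(fineK fin) lte_fin; set r := fine _ => re.
apply/nbhs_ballP; exists ((e - r) / 2)%R => /=; first by rewrite divr_gt0// subr_gt0.
move=> nu'' h''; rewrite (_ : e = (e + r) / 2 + (e - r) / 2)%R; last by lra.
apply: ball_triangle h''; rewrite sharp_ballE /= -(fineK fin) lte_fin -/r; lra.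
Qed.

Lemma sharp_ball_eq nu nu' : (forall e, (0 < e)%R -> ball nu e nu') -> nu = nu'.
Proof.
move=> h; apply: sharp_eq => U oU U1.
  have /nbhs_ballP[e /= e0] : nbhs nu (Lambda U).
    by apply: open_nbhs_nbhs; split => //; exact: open_Lambda.
  by apply; exact: h.
have /nbhs_ballP[e /= e0] : nbhs nu' (Lambda U).
  by apply: open_nbhs_nbhs; split => //; exact: open_Lambda.
by apply; apply: ball_sym; exact: h.
Qed.

(** On the ball a 1-Lipschitz [f] stays within [r] of [f x0], hence so do both quasi-integrals. *)
Lemma Lambda_ball_sub (x0 : X) (r : R) nu nu' : (0 < r)%R ->
  nu (ball x0 r) = 1 -> nu' (ball x0 r) = 1 ->
  (dKR dfc nu nu' <= (2 * r)%:E).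
Proof.
move=> r0 h h'; apply: ge_ereal_sup => _ [f tf <-]; rewrite lee_fin.
have [fc fM] := test_fun_Cc tf.
have [[_ f1] _] := tf.
have fx x : (ball x0 r) x -> (`|f x0 - f x| <= r)%R.
  rewrite ballEmdist /= => xr.
  by apply: le_trans (f1 _ _) _; rewrite mul1r ltW.
have key nu1 : nu1 (ball x0 r) = 1 -> (`|qint f nu1 - f x0| <= r)%R.
  move=> nu1B; rewrite ler_distl; apply/andP; split.
    apply: le_qint nu1B _ => //; first by left; exact: open_ball_metric.
    by move=> x /fx; rewrite ler_norml => /andP[? ?]; lra.
  apply: qint_le nu1B _ => //; first by left; exact: open_ball_metric.
  by move=> x /fx; rewrite ler_norml => /andP[? ?]; lra.
have := key _ h; have := key _ h'; rewrite !ler_norml.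
by move=> /andP[? ?] /andP[? ?]; apply/andP; split; lra.
Qed.

End SharpTopology.

(** * Adjoints of image transformations are contractions *)

Section ImageTransformations.
Context {R : realType} {X : pmetricType R} {dfc : bool}.
Hypothesis lcX : locally_compact [set: X].
Context {q : set X -> set X} {Q : sharp X dfc -> sharp X dfc}.
Hypothesis itq : image_transformation dfc q.
Hypothesis Qq : is_adjoint q Q.
Implicit Types (nu : sharp X dfc) (f : X -> R).

Lemma adjoint_oc (mu : set X -> \bar R) (A : set X) : open A \/ compact A ->
  adjoint q mu A = mu (q A).
Proof. by move=> hA; rewrite /adjoint /extend_oc asboolT. Qed.

Lemma image_transformation_oc (A : set X) : open A \/ compact A ->
  open (q A) \/ compact (q A).
Proof.
by move=> [/(it_open itq)|/(it_compact itq)]; [left|right].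
Qed.

Lemma sharp_adjoint nu (A : set X) : open A \/ compact A ->
  Q nu A = nu (q A).
Proof. by move=> hA; rewrite Qq adjoint_oc. Qed.

Lemma adjoint_preimage_Lambda (A : set X) : open A \/ compact A ->
  Q @^-1` Lambda A = Lambda (q A).
Proof.
by move=> hA; apply/seteqP; split=> nu /=; rewrite /Lambda /= sharp_adjoint.
Qed.

Lemma image_transformation_compact_sub (K U : set X) : compact K -> open U ->
  K `<=` U -> q K `<=` q U.
Proof. by move=> cK oU KU x qKx; rewrite (it_bigcup itq oU); exists K. Qed.

Lemma image_transformation_open_sub (U V : set X) : open U -> open V ->
  U `<=` V -> q U `<=` q V.
Proof.
move=> oU oV UV x; rewrite (it_bigcup itq oU) => -[K [cK KU]].
by apply: image_transformation_compact_sub => //; exact: subset_trans UV.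
Qed.

(** Point masses recover [q] from its adjoint: [Q (delta y)] has value 1 at [A] exactly when [y]
    lies in [q A]. *)
Let delta (y : X) : sharp X dfc := Sharp (point_mass_simple dfc y).

Let deltaE y (A : set X) : open A \/ compact A -> delta y A = 1 <-> A y.
Proof.
move=> hA; rewrite /delta /= /point_mass asboolT; last first.
  by case: hA; [left|right; exact: metric_compact_closed].
rewrite indicE; split=> [|/mem_set -> //].
have [/set_mem//|_] := boolP (y \in A).
by move=> [] /eqP; rewrite eq_sym oner_eq0.
Qed.

Lemma quasi_hom_level f (t : R) : continuous f ->
  (exists M, forall x, (`|f x| <= M)%R) ->
  sup_level (quasi_hom q f) t = q (sup_level f t).
Proof.
move=> fc fM; have oL u : open (sup_level f u) by exact: open_sup_level.
have qE y : quasi_hom q f y = qint f (Q (delta y)) by rewrite Qq.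
have [f1 f2] := (fun y => (qint_simple (Q (delta y)) fc fM).1,
                 fun y => (qint_simple (Q (delta y)) fc fM).2).
apply/seteqP; split => y /=; rewrite qE.
  move=> /f1; rewrite sharp_adjoint; last by left.
  move=> h; apply: (iffLR (deltaE y _)) h; left; exact: (it_open itq (oL _)).
rewrite (it_bigcup itq (oL t)) => -[K [cK KU] qKy].
(* The threshold only yields a weak inequality, so a level with room to spare is needed; on the
   compact [K] that witnesses membership, [f] stays above some [t'] larger than [t]. *)
have [t' tt' KU'] : exists2 t' : R, (t < t')%R & K `<=` sup_level f t'.
  have := cK; move/compact_near_coveringP.
  move=> /(_ R (0^'+)%R (fun e x => sup_level f (t + e) x)) [].
    move=> x /KU /= tx.
    exists (sup_level f ((t + f x) / 2), [set e | (e < (f x - t) / 2)%R]) => /=.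
      split; first by apply: open_nbhs_nbhs; split; [exact: oL|rewrite /=; lra].
      by apply: nbhs_right_lt; rewrite divr_gt0// subr_gt0.
    by move=> [z e] /= [h1 h2]; lra.
  move=> e /= e0 h; exists (t + e / 2)%R; first by rewrite ltrDl divr_gt0.
  apply: (h (e / 2)%R) => /=; last by rewrite divr_gt0.
  by rewrite sub0r normrN gtr0_norm ?divr_gt0// ltr_pdivrMr// ltr_pMr// ltr1n.
apply: lt_le_trans tt' _; apply: f2; rewrite sharp_adjoint; last by left.
apply: (iffRL (deltaE y _)); first by left; exact: (it_open itq (oL _)).
exact: (image_transformation_compact_sub cK (oL _) KU').
Qed.

Context {si s : R}.
Hypotheses (csi : contractivity_factor dfc q si) (sis : (si <= s)%R).

Lemma contractivity_gt0 : (0 < s)%R.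
Proof. by case: csi => /andP[si0 _] _; exact: lt_le_trans sis. Qed.

Lemma test_fun_scaled f : test_fun dfc 1 f ->
  test_fun dfc 1 (fun x => quasi_hom q f x / s)%R.
Proof.
have s0 := contractivity_gt0.
case: csi => _ h /h [[tc tL] [[_ tcc] t0]].
have lip x y : (`|quasi_hom q f x / s - quasi_hom q f y / s| <= 1 * mdist x y)%R.
  rewrite -mulrBl normrM (gtr0_norm (_ : 0 < s^-1)%R) ?invr_gt0//.
  rewrite ler_pdivrMr// mul1r mulrC; apply: le_trans (tL x y) _.
  by rewrite ler_wpM2r ?mdist_ge0.
have cc : continuous (fun x => quasi_hom q f x / s)%R by exact: lipschitz_continuous lip.
split=> //; split; last first.
  by move=> d x; rewrite divr_ge0 ?t0// ltW.
split=> //; rewrite (_ : [set _ | _] = [set x | quasi_hom q f x != 0%R])//.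
by apply/seteqP; split=> x /=; rewrite mulf_eq0 negb_or invr_eq0 (gt_eqF s0) andbT.
Qed.

(** By [quasi_hom_level] both sides have the same threshold. This is the change of variables,
    rescaled so that the new integrand stays 1-Lipschitz. *)
Lemma qint_adjoint f nu : test_fun dfc 1 f ->
  qint f (Q nu) = (s * qint (fun x => quasi_hom q f x / s)%R nu)%R.
Proof.
move=> tf; have s0 := contractivity_gt0.
have [fc fM] := test_fun_Cc tf; have [gc gM] := test_fun_Cc (test_fun_scaled tf).
apply: qint_simple_eq => // t.
rewrite sharp_adjoint; last by left; exact: open_sup_level.
rewrite -quasi_hom_level//.
rewrite (_ : sup_level _ (s * t) =
             sup_level (fun x => quasi_hom q f x / s)%R t)//.
by apply/seteqP; split=> x /=; rewrite ltr_pdivlMr// mulrC.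
Qed.

Lemma adjoint_ball nu nu' e : ball nu e nu' -> ball (Q nu) (s * e) (Q nu').
Proof.
have s0 := contractivity_gt0.
rewrite !sharp_ballE /= => h.
have fin : dKR dfc nu nu' \is a fin_num.
  by rewrite ge0_fin_numE ?(dKR_ge0 lcX)// (lt_trans h)// ltry.
apply: (@le_lt_trans _ _ (s%:E * dKR dfc nu nu')); last first.
  by rewrite EFinM lte_pmul2l// lte_fin.
apply: ge_ereal_sup => _ [f tf <-].
rewrite !qint_adjoint// -mulrBr normrM (gtr0_norm s0) EFinM.
rewrite lee_pmul2l// ?lte_fin//; apply: dKR_ge; exact: test_fun_scaled.
Qed.

Lemma adjoint_continuous : continuous Q.
Proof.
have s0 := contractivity_gt0.
move=> nu B /nbhs_ballP[e /= e0 eB]; apply/nbhs_ballP.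
exists (e / s)%R => /=; first by rewrite divr_gt0.
move=> nu' /adjoint_ball; rewrite mulrC divfK ?gt_eqF// => h; exact: eB.
Qed.

End ImageTransformations.

(** * Probabilities on the space of simple measures *)

Section SharpProbability.
Context {R : realType} {X : pmetricType R} {dfc : bool}.
Hypothesis lcX : locally_compact [set: X].
Context {m : probability (borel_sharp X dfc) R}.
Implicit Types (nu : sharp X dfc) (U : set (sharp X dfc)).

Lemma open_measurable_sharp U : open U -> measurable (U : set (borel_sharp X dfc)).
Proof. by move=> oU; apply: sub_sigma_algebra. Qed.

Lemma closed_measurable_sharp U :
  closed U -> measurable (U : set (borel_sharp X dfc)).
Proof.
by rewrite -openC -[U in measurable U]setCK => /open_measurable_sharp; exact: measurableC.
Qed.

Lemma measurable_Lambda (A : set X) : open A \/ compact A ->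
  measurable (Lambda A : set (borel_sharp X dfc)).
Proof.
move=> [oA|cA]; first by apply: open_measurable_sharp; exact: open_Lambda.
by apply: closed_measurable_sharp; exact: closed_Lambda.
Qed.

Lemma le_prob (A B : set (borel_sharp X dfc)) : measurable A -> measurable B ->
  A `<=` B -> m A <= m B.
Proof. by move=> mA mB; apply: le_measure; rewrite inE. Qed.

Lemma Lambda_sub (A B : set X) : open A \/ compact A -> open B \/ compact B ->
  A `<=` B -> Lambda A `<=` (Lambda B : set (sharp X dfc)).
Proof.
have oc (C : set X) : open C \/ compact C -> open C \/ closed C.
  by move=> [oC|cC]; [left|right; exact: metric_compact_closed].
by move=> /oc hA /oc hB AB nu; exact: sharpS.
Qed.

Lemma prob_Lambda_le (A B : set X) : open A \/ compact A -> open B \/ compact B ->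
  A `<=` B -> m (Lambda A) <= m (Lambda B).
Proof.
by move=> hA hB AB; apply: le_prob; [exact: measurable_Lambda..|exact: Lambda_sub].
Qed.

Lemma prob_bigcup_le (F : nat -> set (sharp X dfc)) (b : \bar R) :
  (forall n, open (F n)) -> nondecreasing_seq F -> (forall n, m (F n) <= b) ->
  m (\bigcup_n F n) <= b.
Proof.
move=> oF ndF Fb.
have cv : m \o F @ \oo --> m (\bigcup_n F n).
  apply: (@nondecreasing_cvg_mu _ (borel_sharp X dfc) R m F) => //.
    by move=> n; exact: open_measurable_sharp.
  by apply: open_measurable_sharp; exact: bigcup_open.
rewrite -(cvg_lim (@ereal_hausdorff R) cv); apply: lime_le.
  by apply/cvg_ex; exists (m (\bigcup_n F n)).
by apply: nearW.
Qed.

(* Every simple measure is carried by a bounded set, hence m is bounded up to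
   any error, although X need not be separable. *)
Lemma prob_Lambda_ball (x0 : X) (e : R) : (0 < e)%R ->
  exists2 r : R, (0 < r)%R & (1 - e)%:E <= m (Lambda (ball x0 r)).
Proof.
move=> e0; apply: contrapT => /forall2NP h.
pose F n : set (sharp X dfc) := Lambda (ball x0 n.+1%:R).
have oB r : open (ball x0 r) \/ compact (ball x0 r) by left; exact: open_ball_metric.
have FT : \bigcup_n F n = setT.
  apply/seteqP; split=> // nu _.
  have [K [cK _ K1]] := sharp_inner openT (sharpT nu).
  have [r r0 Kr] := compact_sub_ball x0 cK.
  exists (Num.truncn r) => //; rewrite /F /Lambda /=; apply: sharpS K1.
  - by right; exact: metric_compact_closed.
  - by left; exact: open_ball_metric.
  - apply: subset_trans Kr _; apply: le_ball; exact/ltW/truncnS_gt.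
have : m (\bigcup_n F n) <= (1 - e)%:E.
  apply: prob_bigcup_le.
  - by move=> n; apply: open_Lambda => //; exact: open_ball_metric.
  - move=> i j ij; apply/subsetPset; apply: Lambda_sub => //.
    by apply: le_ball; rewrite ler_nat.
  - move=> n; have [|/negP] := h n.+1%:R; first by rewrite ltr0n.
    by rewrite -ltNge => /ltW.
by rewrite FT probability_setT lee_fin; lra.
Qed.

(** Total boundedness up to small mass: a substitute for tightness on a space that need be neither
    separable nor complete. *)
Definition nearly_finite (P : probability (borel_sharp X dfc) R) :=
  forall e d : R, (0 < e)%R -> (0 < d)%R ->
  exists l : seq (sharp X dfc),
    (1 - e)%:E <= P (\bigcup_(c in [set` l]) ball c d).

(** Countable additivity does not reach uncountable unions. Points having a ball of fixed radius
    inside some [U i] are covered, up to mass [e], by finitely many small balls, and directedness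
    merges the finitely many [U i] involved into one. *)
Lemma nearly_finite_directed (I : Type) (D : set I) (U : I -> set (sharp X dfc))
    (b : \bar R) :
  nearly_finite m -> D !=set0 -> (forall i, D i -> open (U i)) ->
  (forall i j, D i -> D j -> exists2 k, D k & U i `|` U j `<=` U k) ->
  (forall i, D i -> m (U i) <= b) -> m (\bigcup_(i in D) U i) <= b.
Proof.
move=> tb D0 oU dirU Ub.
(* A Lebesgue number condition with radius [n.+1%:R^-1]; interiors are taken below to secure
   measurability. *)
pose G (n : nat) : set (sharp X dfc) :=
  [set nu | exists2 i, D i & ball nu n.+1%:R^-1 `<=` U i].
have ndG n n' : (n <= n')%N -> G n `<=` G n'.
  move=> nn' nu [i Di nuU]; exists i => //; apply: subset_trans nuU.
  by apply: le_ball; rewrite lef_pV2 ?posrE ?ltr0n// ler_nat.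
have -> : \bigcup_(i in D) U i = \bigcup_n (G n)^°.
  apply/seteqP; split=> [nu [i Di Unu]|nu [n _ /interior_subset[i Di]]]; last first.
    by move=> h; exists i => //; apply: h; apply: ballxx; rewrite invr_gt0 ltr0n.
  have /nbhs_ballP[e /= e0 eU] : nbhs nu (U i).
    by apply: open_nbhs_nbhs; split=> //; exact: oU.
  pose n := Num.truncn (e / 2)^-1.
  have ne : (n.+1%:R^-1 <= e / 2 :> R)%R.
    rewrite -[leRHS]invrK lef_pV2 ?posrE ?invr_gt0 ?ltr0n ?divr_gt0//.
    exact/ltW/truncnS_gt.
  exists n => //; apply/nbhs_ballP; exists (e / 2)%R; first by rewrite /= divr_gt0.
  move=> nu' nu'B; exists i => // nu'' h; apply: eU.
  by apply: (ball_split nu'B); apply: le_ball h.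
apply: prob_bigcup_le => [n|n n' nn'|n].
- exact: open_interior.
- by apply/subsetPset; apply: interiorS; exact: ndG.
apply/lee_addgt0Pr => e e0.
(* Half the radius: a [d]-ball that meets [G n] in [nu] lies in the ball of radius [n.+1%:R^-1]
   about [nu], hence in a single [U i]. *)
pose d : R := (n.+1%:R^-1 / 2)%R.
have d0 : (0 < d)%R by rewrite divr_gt0// invr_gt0 ltr0n.
have [l Pl] := tb e d e0 d0.
set P := \bigcup_(c in _) _ in Pl.
have oP : open P by apply: bigcup_open => c _; exact: open_ball_sharp.
have [k Dk kl] : exists2 k, D k & G n `&` P `<=` U k.
  rewrite /P; elim: (l) => [|c l' [k Dk IH]].
    by case: D0 => k Dk; exists k => // nu [_ []].
  have [[nu [ncd [i Di nuU]]]|nGc] := pselect (ball c d `&` G n !=set0).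
    have [k' Dk' ikk'] := dirU _ _ Di Dk; exists k' => //.
    move=> nu' [Gnu' [c' /=]]; rewrite inE => /orP[/eqP ->|c'l] h; apply: ikk'.
      by left; apply: nuU; apply: (@ball_splitr _ _ c).
    by right; apply: IH; split=> //; exists c'.
  exists k => // nu' [Gnu' [c' /=]]; rewrite inE => /orP[/eqP ->|c'l] h.
    by exfalso; apply: nGc; exists nu'.
  by apply: IH; split=> //; exists c'.
apply: (@le_trans _ _ (m (U k `|` ~` P))).
  apply: le_prob.
  - by apply: open_measurable_sharp; exact: open_interior.
  - apply: measurableU; first by apply: open_measurable_sharp; exact: oU.
    by apply: measurableC; exact: open_measurable_sharp.
  - move=> nu /interior_subset Gnu; have [Pnu|] := pselect (P nu); last by right.
    by left; exact: kl.
apply: le_trans (measureU2 _ _ _) _.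
- by apply: open_measurable_sharp; exact: oU.
- by apply: measurableC; exact: open_measurable_sharp.
apply: leeD; first exact: Ub.
have mP : measurable (P : set (borel_sharp X dfc)) by exact: open_measurable_sharp.
change (m (~` P) <= e%:E).
have -> : m (~` P) = 1 - m P := probability_setC m mP.
move: Pl; rewrite -(fineK (fin_num_measure m P mP)) -EFinB !lee_fin; lra.
Qed.

End SharpProbability.

(** * Fixed points of the Markov operators *)

Section MarkovFixedPoints.
Context {R : realType} {X : pmetricType R} {dfc : bool}.
Hypothesis lcX : locally_compact [set: X].
Context {q : nat -> set X -> set X} {Q : nat -> sharp X dfc -> sharp X dfc}.
Context {si alpha : nat -> R} {s : R}.
Hypothesis itq : forall i, image_transformation dfc (q i).
Hypothesis csi : forall i, contractivity_factor dfc (q i) (si i) /\ (si i <= s)%R.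
Hypothesis s1 : (s < 1)%R.
Hypothesis alpha0 : forall i, (0 <= alpha i)%R.
Hypothesis Qq : forall i, is_adjoint (q i) (Q i).
Implicit Types (nu : sharp X dfc) (f : X -> R).

Let s0 : (0 < s)%R. Proof. by have [c h] := csi 0; exact: contractivity_gt0 c h. Qed.

Let Qball i nu nu' e : ball nu e nu' -> ball (Q i nu) (s * e) (Q i nu').
Proof. by have [c h] := csi i; exact: (adjoint_ball lcX (itq i) (Qq i) c h). Qed.

Let Qcont i : continuous (Q i).
Proof. by have [c h] := csi i; exact: (adjoint_continuous lcX (itq i) (Qq i) c h). Qed.

Lemma exists_expr_lt (C d : R) : (0 < d)%R -> exists n, (C * s ^+ n < d)%R.
Proof.
move=> d0; have C1 : (0 < `|C| + 1)%R by rewrite ltr_wpDl.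
have : (`|s| < 1)%R by rewrite gtr0_norm.
move=> /cvg_expr/cvgrPdist_lt/(_ (d / (`|C| + 1)))%R.
rewrite divr_gt0// => /(_ isT)[n _ /(_ n (leqnn n))] /=.
rewrite sub0r normrN gtr0_norm ?exprn_gt0// ltr_pdivlMr// => h; exists n.
apply: le_lt_trans h; rewrite mulrC ler_wpM2l ?exprn_ge0 ?(ltW s0)//.
by rewrite (le_trans (ler_norm C))// lerDl.
Qed.

Section FixedProbability.
Context {m : probability (borel_sharp X dfc) R}.
Hypothesis fixm : forall B : set (borel_sharp X dfc), measurable B ->
  markov_prob alpha Q m B = m B.

(** Invariance tested on the whole space: an invariant probability exists only when the weights add
    up to 1. *)
Lemma markov_prob_sum1 : \sum_(0 <= i <oo) (alpha i)%:E = 1.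
Proof.
rewrite -[RHS](probability_setT m) -fixm ?measurableT//; apply: eq_eseriesr => i _.
by rewrite preimage_setT probability_setT mule1.
Qed.

Definition balls (l : seq (sharp X dfc)) (r : R) : set (sharp X dfc) :=
  \bigcup_(c in [set` l]) ball c r.

Definition adjoint_images (N : nat) (l : seq (sharp X dfc)) :=
  [seq Q i c | i <- iota 0 N, c <- l].

Lemma open_balls l r : open (balls l r).
Proof. by apply: bigcup_open => c _; exact: open_ball_sharp. Qed.

Lemma measurable_balls l r : measurable (balls l r : set (borel_sharp X dfc)).
Proof. by apply: open_measurable_sharp; exact: open_balls. Qed.

(** [Q i] maps a ball about [c] into a ball about [Q i c] with radius smaller by the factor [s].
    Cutting the series at [N] keeps the set of centres finite. *)
Lemma prob_adjoint_images N l r :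
  \sum_(0 <= i < N) (alpha i)%:E * m (balls l r) <=
  m (balls (adjoint_images N l) (s * r)).
Proof.
rewrite -[leRHS]fixm; last exact: measurable_balls.
apply: (@le_trans _ _ (\sum_(0 <= i < N) (alpha i)%:E *
    m (Q i @^-1` balls (adjoint_images N l) (s * r)))); last first.
  rewrite /markov_prob; apply: nneseries_lim_ge => i _ _; apply: mule_ge0 => //.
  by rewrite lee_fin.
rewrite !big_seq; apply: lee_sum => i; rewrite mem_index_iota => /andP[_ iN].
apply: lee_wpmul2l; first by rewrite lee_fin.
apply: le_prob.
- exact: measurable_balls.
- apply: open_measurable_sharp; apply: open_comp => [nu _|]; first exact: Qcont.
  exact: open_balls.
- move=> nu [c /= cl h]; exists (Q i c) => /=; last exact: Qball.
  by apply/allpairsP; exists (i, c); split => //; rewrite mem_iota.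
Qed.

(** The strict inequality pays for the tail lost by truncation: as the weights add up to 1, some
    partial sum still exceeds [k]. *)
Lemma prob_adjoint_images_lt (k : \bar R) l r : k < m (balls l r) ->
  exists l', k < m (balls l' (s * r)).
Proof.
move=> kl; apply: contrapT => /forallNP h.
have mb : m (balls l r) \is a fin_num.
  by apply: fin_num_measure; exact: measurable_balls.
have : \sum_(0 <= i <oo) (alpha i)%:E * m (balls l r) <= k.
  apply: lime_le.
    by apply: is_cvg_nneseries => i _ _; rewrite mule_ge0// lee_fin.
  apply: nearW => N; apply: le_trans (prob_adjoint_images N l r) _.
  by rewrite leNgt; apply/negP; exact: h.
rewrite -(fineK mb).
under eq_eseriesr => i _ do rewrite muleC.
rewrite nneseriesZl ?markov_prob_sum1 ?mule1 ?fineK//; last first.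
  by move=> i _; rewrite lee_fin.
by rewrite leNgt kl.
Qed.

Lemma prob_ball_point_mass (x0 : X) (e : R) : (0 < e)%R -> exists r,
  (1 - e)%:E <= m (ball (Sharp (point_mass_simple dfc x0)) r).
Proof.
move=> e0; have [r r0 h] := prob_Lambda_ball lcX (m := m) x0 e0.
exists (2 * r + 1)%R; apply: le_trans h _; apply: le_prob.
- by apply: measurable_Lambda => //; left; exact: open_ball_metric.
- apply: open_measurable_sharp; exact: open_ball_sharp.
- move=> nu h; rewrite sharp_ballE /=.
  apply: (@le_lt_trans _ _ (2 * r)%:E); last by rewrite lte_fin ltrDl.
  have d1 : Sharp (point_mass_simple dfc x0) (ball x0 r) = 1.
    rewrite /= /point_mass asboolT; last by left; exact: open_ball_metric.
    by rewrite indicE mem_set//; exact: ballxx.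
  exact: (Lambda_ball_sub r0 d1 h).
Qed.

(** One large ball carries almost all the mass, and [n] passages to images trade it for finitely
    many balls of radius [r * s ^+ n]. *)
Lemma nearly_finite_fixed : nearly_finite m.
Proof.
move=> e d e0 d0.
(* Starting from [e / 2] gives the strict inequality that the iteration preserves. *)
have [r hr] := prob_ball_point_mass point (divr_gt0 e0 (ltr0Sn R 1)).
set nu0 := Sharp _ in hr.
have [n rn] := exists_expr_lt r d0.
have [l hl] : exists l, (1 - e)%:E < m (balls l (r * s ^+ n)).
  elim: n {rn} => [|n [l IH]]; last first.
    by rewrite exprS mulrCA; exact: prob_adjoint_images_lt IH.
  exists [:: nu0]; apply: (@lt_le_trans _ _ (1 - e / 2)%:E).
    by rewrite lte_fin; lra.
  apply: le_trans hr _; apply: le_prob.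
  - apply: open_measurable_sharp; exact: open_ball_sharp.
  - exact: measurable_balls.
  - by move=> nu h; exists nu0; rewrite /= ?inE// expr0 mulr1.
exists l; apply: le_trans (ltW hl) _; apply: le_prob.
- exact: measurable_balls.
- exact: measurable_balls.
- by move=> nu [c cl h]; exists c => //; apply: le_ball h; exact: ltW.
Qed.

End FixedProbability.

(** For topological measures the contractivity hypothesis says nothing about signs; nonnegativity is
    inherited from [f] through the quasi-integral. *)
Lemma test_fun_scaled_nneg i f : test_fun true 1 f ->
  test_fun true 1 (fun x => quasi_hom (q i) f x / s)%R.
Proof.
move=> tf; have [c h] := csi i; have [fc fM] := test_fun_Cc tf.
have [? [? _]] := test_fun_scaled c h (test_fun_nneg (dfc := dfc) tf).
split=> //; split=> // _ x; apply: divr_ge0; last exact: ltW.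
have -> : quasi_hom (q i) f x = qint f (Q i (Sharp (point_mass_simple dfc x))).
  by rewrite Qq.
apply: (le_qint fc fM _ (sharpT _)); first by left; exact: openT.
by move=> y _; case: tf => _ [_]; apply.
Qed.

(* A set function invariant under the Markov operator is determined up to eps
   by its values on superlevel sets of functions with small Lipschitz constant,
   which either contain a ball carrying almost all the mass or barely meet it. *)
Lemma invariant_sup_level_le (phi1 phi2 : set X -> \bar R) (x0 : X) :
  \sum_(0 <= i <oo) (alpha i)%:E <= 1 ->
  (forall U, 0 <= phi1 U) -> (forall U, 0 <= phi2 U) ->
  (forall U, open U -> phi1 U <= 1) ->
  (forall U V, open U -> open V -> U `<=` V -> phi2 U <= phi2 V) ->
  (forall U, open U -> \sum_(0 <= i <oo) (alpha i)%:E * phi1 (q i U) = phi1 U) ->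
  (forall U, open U -> \sum_(0 <= i <oo) (alpha i)%:E * phi2 (q i U) = phi2 U) ->
  (forall e : R, (0 < e)%R -> exists2 r : R, (1 - e)%:E <= phi2 (ball x0 r) &
    forall U, open U -> U `&` ball x0 r = set0 -> phi1 U <= e%:E) ->
  forall f (t eta : R), test_fun true 1 f -> (0 < eta)%R ->
    phi1 (sup_level f (t + eta)) <= phi2 (sup_level f t).
Proof.
move=> alpha1 phi10 phi20 phi11 phi2S fix1 fix2 tight f t eta tf eta0.
apply/lee_addgt0Pr => e e0; have [r r2 r1] := tight e e0.
(* Each step divides [eta] by [s]; after [n] steps it exceeds [2 * r], a bound for the variation of
   a 1-Lipschitz function on [ball x0 r]. *)
have [n rn] := exists_expr_lt (2 * r) eta0.
elim: n f t eta tf eta0 rn => [|n IH] f t eta tf eta0 rn.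
  have [fc _] := test_fun_Cc tf; have [[_ f1] _] := tf.
  have oL u : open (sup_level f u) by exact: open_sup_level.
  have [Bt|Bt] := pselect (ball x0 r `<=` sup_level f t).
    apply: (@le_trans _ _ 1); first exact: phi11.
    apply: (@le_trans _ _ ((1 - e)%:E + e%:E)).
      by rewrite -EFinD subrK.
    by apply: leeD => //; apply: le_trans r2 _; apply: phi2S => //; exact: open_ball_metric.
  apply: (@le_trans _ _ e%:E); last by rewrite leeDr.
  have [y [yB /negP]] : exists y, ball x0 r y /\ ~ (t < f y)%R.
    by apply: contrapT => /forallNP h; apply: Bt => y yB; apply: contrapT => ?; exact: (h y).
  rewrite -leNgt => fyt; apply: r1 => //; rewrite -subset0 => x [/= tfx].
  move: yB; rewrite ballEmdist /= => yB xB.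
  have := f1 x y; rewrite ler_norml mul1r => /andP[_].
  have := metric_triangle x x0 y; rewrite (metric_sym x x0).
  by move: rn; rewrite expr0 mulr1; lra.
have [fc fM] := test_fun_Cc tf.
have oL u : open (sup_level f u) by exact: open_sup_level.
rewrite -(fix1 _ (oL _)) -(fix2 _ (oL _)).
have key i : phi1 (q i (sup_level f (t + eta))) <= phi2 (q i (sup_level f t)) + e%:E.
  have lv u : q i (sup_level f u) = sup_level (fun x => quasi_hom (q i) f x / s)%R (u / s).
    rewrite -(quasi_hom_level (itq i) (Qq i))//.
    by apply/seteqP; split=> x /=; rewrite ltr_pM2r ?invr_gt0.
  rewrite !lv mulrDl; apply: IH.
  - exact: test_fun_scaled_nneg.
  - by rewrite divr_gt0.
  - by rewrite ltr_pdivlMr// -[ltLHS]mulrA -exprSr.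
(* The error [e] is averaged with weights of sum at most 1, so it does not grow along the
   induction. *)
apply: (@le_trans _ _ (\sum_(0 <= i <oo)
    ((alpha i)%:E * phi2 (q i (sup_level f t)) + e%:E * (alpha i)%:E))).
  apply: lee_nneseries => [i _ _|i _]; first by rewrite mule_ge0// lee_fin.
  by rewrite [e%:E * _]muleC -ge0_muleDr ?lee_fin ?(ltW e0)// lee_wpmul2l// lee_fin.
rewrite nneseriesD; last 2 first.
  by move=> i _ _; rewrite mule_ge0// lee_fin.
  by move=> i _ _; rewrite mule_ge0// lee_fin// ltW.
rewrite leeD2l// nneseriesZl; last by move=> i _; rewrite lee_fin.
by rewrite -[leRHS]mule1 lee_wpmul2l// lee_fin ltW.
Qed.

End MarkovFixedPoints.

(** * Comparison of an invariant measure with the barycenter *)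

Section FixedPoints.
Context {R : realType} {X : pmetricType R} {dfc : bool}.
Hypothesis lcX : locally_compact [set: X].

(** No additivity is assumed of [phi], so smallness off the ball is a separate clause; all large
    radii are allowed so that two set functions can share one ball. *)
Definition tight_at (x0 : X) (phi : set X -> \bar R) := forall e : R, (0 < e)%R ->
  exists r0 : R, forall r, (r0 <= r)%R -> (1 - e)%:E <= phi (ball x0 r) /\
    forall U, open U -> U `&` ball x0 r = set0 -> phi U <= e%:E.

Lemma tm_tight (mu : set X -> \bar R) (x0 : X) : topological_measure dfc mu ->
  mu setT = 1 -> tight_at x0 mu.
Proof.
move=> tmu mu1 e e0.
have [|K [cK _ eK]] := tm_inner_lt (r := (1 - e)%:E) tmu openT.
  by rewrite mu1 lte_fin; lra.
have [r0 _ Kr0] := compact_sub_ball x0 cK; exists r0 => r r0r.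
have Kr : K `<=` ball x0 r by apply: subset_trans Kr0 _; exact: le_ball.
split.
  apply: le_trans (ltW eK) _; apply: (tm_le tmu) => //.
    by right; exact: metric_compact_closed.
  by left; exact: open_ball_metric.
move=> U oU Ur; apply: (tm_inner tmu) => // C cC CU.
have CK : C `&` K = set0 by rewrite -subset0 -Ur => x [/CU ? /Kr].
have := tm_compact_superadd tmu cC cK CK (or_introl openT) (@subsetT _ _).
rewrite mu1 => CK1.
have fK : mu K \is a fin_num.
  rewrite ge0_fin_numE; last exact: tm_ge0 tmu K.
  apply: le_lt_trans (ltry 1); apply: le_trans CK1; rewrite leeDr//.
  exact: tm_ge0 tmu C.
have fC : mu C \is a fin_num.
  rewrite ge0_fin_numE; last exact: tm_ge0 tmu C.
  apply: le_lt_trans (ltry 1); apply: le_trans CK1; rewrite leeDl//.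
  exact: tm_ge0 tmu K.
by move: CK1 eK; rewrite -(fineK fK) -(fineK fC) -EFinD !lee_fin lte_fin; lra.
Qed.

Lemma prob_tight (m : probability (borel_sharp X dfc) R) (x0 : X) :
  tight_at x0 (fun U => m (Lambda U)).
Proof.
move=> e e0; have [r0 _ h] := prob_Lambda_ball lcX (m := m) x0 e0.
have oB r : open (ball x0 r) \/ compact (ball x0 r) by left; exact: open_ball_metric.
exists r0 => r r0r.
have hr : (1 - e)%:E <= m (Lambda (ball x0 r)).
  by apply: le_trans h _; apply: prob_Lambda_le => //; exact: le_ball.
split=> // U oU Ur.
have mB : measurable (Lambda (ball x0 r) : set (borel_sharp X dfc)).
  exact: measurable_Lambda.
apply: (@le_trans _ _ (m (~` Lambda (ball x0 r)))).
  apply: le_prob.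
  - by apply: measurable_Lambda => //; left.
  - exact: measurableC.
  - by move=> nu U1 B1; apply: (sharp_disj (nu := nu) _ (oB r) Ur) => //; left.
have -> : m (~` Lambda (ball x0 r)) = 1 - m (Lambda (ball x0 r)) :=
  probability_setC m mB.
by move: hr; rewrite -(fineK (fin_num_measure m _ mB)) -EFinB !lee_fin; lra.
Qed.

(* Compact sets have a countable base of neighbourhoods, so that outer
   regularity passes to m \o Lambda. *)
Lemma prob_Lambda_outer (m : probability (borel_sharp X dfc) R) (K : set X)
    (b : \bar R) : compact K ->
  (forall U, open U -> K `<=` U -> b <= m (Lambda U)) -> b <= m (Lambda K).
Proof.
move=> cK h.
pose U n : set X := \bigcup_(k in K) ball k n.+1%:R^-1.
have oU n : open (U n) by apply: bigcup_open => k _; exact: open_ball_metric.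
have KU n : K `<=` U n.
  by move=> k Kk; exists k => //; apply: ballxx; rewrite invr_gt0 ltr0n.
pose F n : set (borel_sharp X dfc) := Lambda (U n).
have mF n : measurable (F n) by apply: measurable_Lambda => //; left.
have FK : \bigcap_n F n = Lambda K.
  apply/seteqP; split=> nu; last first.
    move=> nuK n _; apply: sharpS nuK => //; last by left.
    by right; exact: metric_compact_closed.
  move=> nuF; apply: contrapT => /(sharp_outer (metric_compact_closed cK))[V [oV KV nuV]].
  have [e e0 eV] := compact_uniform_ball cK oV KV.
  apply: nuV; apply: (sharpS _ _ _ (nuF (Num.truncn e^-1) I)); [by left|by left|].
  move=> x [k Kk]; rewrite ballEmdist /= => kx; apply: eV Kk _.
  apply: lt_le_trans kx _; rewrite -[leRHS]invrK lef_pV2 ?posrE ?invr_gt0 ?ltr0n//.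
  exact/ltW/truncnS_gt.
have cv : m \o F @ \oo --> m (\bigcap_n F n).
  apply: (@nonincreasing_cvg_mu _ (borel_sharp X dfc) R m F) => //.
  - exact: (le_lt_trans (probability_le1 m (mF 0%N)) (ltry 1)).
  - by apply: bigcap_measurable => // n _.
  - move=> i j ij; apply/subsetPset; apply: Lambda_sub; [by left|by left|].
    move=> x [k Kk kx]; exists k => //; apply: le_ball kx.
    by rewrite lef_pV2 ?posrE ?ltr0n// ler_nat.
rewrite -FK -(cvg_lim (@ereal_hausdorff R) cv); apply: lime_ge.
  by apply/cvg_ex; exists (m (\bigcap_n F n)).
by apply: nearW => n; exact: h.
Qed.

Context {q : nat -> set X -> set X} {Q : nat -> sharp X dfc -> sharp X dfc}.
Context {si alpha : nat -> R} {s : R}.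
Hypothesis itq : forall i, image_transformation dfc (q i).
Hypothesis csi : forall i, contractivity_factor dfc (q i) (si i) /\ (si i <= s)%R.
Hypothesis s1 : (s < 1)%R.
Hypothesis alpha0 : forall i, (0 <= alpha i)%R.
Hypothesis Qq : forall i, is_adjoint (q i) (Q i).
Implicit Types (nu : sharp X dfc) (f : X -> R).

(** A bump function of height [c] on [closure W] puts [W] above the level [c / 2], while its points
    above the level 0 lie in [U]; the gap between the levels is [c / 2]. *)
Lemma invariant_le (phi1 phi2 : set X -> \bar R) (x0 : X) (W U : set X) :
  \sum_(0 <= i <oo) (alpha i)%:E <= 1 ->
  (forall A, 0 <= phi1 A) -> (forall A, 0 <= phi2 A) ->
  (forall V, open V -> phi1 V <= 1) ->
  (forall V V', open V -> open V' -> V `<=` V' -> phi1 V <= phi1 V') ->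
  (forall V V', open V -> open V' -> V `<=` V' -> phi2 V <= phi2 V') ->
  (forall V, open V -> \sum_(0 <= i <oo) (alpha i)%:E * phi1 (q i V) = phi1 V) ->
  (forall V, open V -> \sum_(0 <= i <oo) (alpha i)%:E * phi2 (q i V) = phi2 V) ->
  tight_at x0 phi1 -> tight_at x0 phi2 ->
  open W -> open U -> compact (closure W) -> closure W `<=` U ->
  phi1 W <= phi2 U.
Proof.
move=> alpha1 phi10 phi20 phi11 phi1S phi2S fix1 fix2 t1 t2 oW oU cW WU.
have [f [c [c0 tf f0c fW fU]]] := bump_function lcX cW oU WU.
have [fc _] := test_fun_Cc tf.
have oL u : open (sup_level f u) by exact: open_sup_level.
apply: (@le_trans _ _ (phi1 (sup_level f (0 + c / 2)))).
  apply: phi1S => // x Wx /=; rewrite fW ?add0r; last exact: subset_closure.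
  by lra.
apply: (@le_trans _ _ (phi2 (sup_level f 0))); last exact: phi2S.
apply: (invariant_sup_level_le (x0 := x0) itq csi s1 alpha0 Qq) => //.
  move=> e e0; have [r1 h1] := t1 e e0; have [r2 h2] := t2 e e0.
  exists (Num.max r1 r2).
    by apply: (h2 _ _).1; rewrite le_max lexx orbT.
  by apply: (h1 _ _).2; rewrite le_max lexx.
by rewrite divr_gt0.
Qed.

Lemma markov_tm_oc (mu : set X -> \bar R) (A : set X) : open A \/ compact A ->
  markov_tm alpha q mu A = \sum_(0 <= i <oo) (alpha i)%:E * mu (q i A).
Proof. by move=> hA; apply: eq_eseriesr => i _; rewrite adjoint_oc. Qed.

Lemma markov_prob_Lambda (m : set (sharp X dfc) -> \bar R) (A : set X) :
  open A \/ compact A ->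
  markov_prob alpha Q m (Lambda A) =
  \sum_(0 <= i <oo) (alpha i)%:E * m (Lambda (q i A)).
Proof.
move=> hA; apply: eq_eseriesr => i _.
by rewrite (adjoint_preimage_Lambda (Qq i)).
Qed.

Section FixedProbability.
Context {m : probability (borel_sharp X dfc) R}.
Hypothesis fixm : forall B : set (borel_sharp X dfc), measurable B ->
  markov_prob alpha Q m B = m B.

Lemma fixed_point_barycenter (mu : set X -> \bar R) :
  topological_measure dfc mu -> markov_tm alpha q mu = mu -> mu setT = 1 ->
  mu = comp_Lambda m.
Proof.
move=> tmu fixmu mu1.
have tb : nearly_finite m by exact: (nearly_finite_fixed lcX itq csi s1 alpha0 Qq fixm).
have a1 : \sum_(0 <= i <oo) (alpha i)%:E <= 1.
  by rewrite (markov_prob_sum1 fixm).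
pose phi U : \bar R := m (Lambda U).
have phi0 U : 0 <= phi U by exact: measure_ge0.
have phiS V V' : open V -> open V' -> V `<=` V' -> phi V <= phi V'.
  by move=> ? ?; apply: prob_Lambda_le => //; left.
have phi1 V : open V -> phi V <= 1.
  by move=> oV; apply: probability_le1; apply: measurable_Lambda => //; left.
have muS V V' : open V -> open V' -> V `<=` V' -> mu V <= mu V'.
  by move=> ? ?; apply: (tm_le tmu); left.
have mu11 V : open V -> mu V <= 1.
  by move=> oV; rewrite -mu1; apply: muS => //; exact: openT.
have fixphi V : open V -> \sum_(0 <= i <oo) (alpha i)%:E * phi (q i V) = phi V.
  move=> oV; rewrite /phi -markov_prob_Lambda; last by left.
  by rewrite fixm//; apply: measurable_Lambda => //; left.
have fixmu' V : open V -> \sum_(0 <= i <oo) (alpha i)%:E * mu (q i V) = mu V.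
  by move=> oV; rewrite -markov_tm_oc ?fixmu//; left.
have tmu' : tight_at point mu by exact: tm_tight.
have tphi := prob_tight m point.
have leL W U : open W -> open U -> compact (closure W) -> closure W `<=` U ->
    mu W <= phi U /\ phi W <= mu U.
  move=> oW oU cW WU; split.
    by apply: (invariant_le a1 (tm_ge0 tmu) phi0 mu11 muS phiS fixmu' fixphi tmu' tphi).
  by apply: (invariant_le a1 phi0 (tm_ge0 tmu) phi1 phiS muS fixphi fixmu' tphi tmu').
have muphi U : open U -> mu U = phi U.
  move=> oU; apply/eqP; rewrite eq_le; apply/andP; split.
    apply: (tm_inner tmu) => // K cK KU.
    have [V [oV KV VU cV]] := compact_open_between lcX cK oU KU.
    apply: le_trans (leL V U oV oU cV VU).1.
    by apply: (tm_le tmu) => //; [right; exact: metric_compact_closed|left].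
  (* [leL] controls [phi] only on open sets with compact closure inside [U]. These exhaust
     [Lambda U] as a directed family that may be uncountable, hence the appeal to
     [nearly_finite_directed]. *)
  pose D : set (set X) := [set V | [/\ open V, compact (closure V) & closure V `<=` U]].
  have between K : compact K -> K `<=` U -> exists2 V, D V & K `<=` V.
    move=> cK KU; have [V [oV KV VU cV]] := compact_open_between lcX cK oU KU.
    by exists V.
  rewrite /phi (_ : Lambda U = \bigcup_(V in D) (Lambda V : set (sharp X dfc))).
    apply: (nearly_finite_directed lcX tb).
    - by have [V DV _] := between set0 compact0 (sub0set _); exists V.
    - by move=> V [oV _ _]; exact: open_Lambda.
    - move=> V V' [oV cV VU] [oV' cV' VU'].
      have [|V'' DV''] := between (closure V `|` closure V') (compactU cV cV').
        by rewrite subUset.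
      rewrite subUset => -[VV'' V'V'']; exists V'' => //.
      have [oV'' _ _] := DV''.
      rewrite subUset; split; apply: Lambda_sub; try (by left).
        exact: subset_trans (@subset_closure _ _) VV''.
      exact: subset_trans (@subset_closure _ _) V'V''.
    - by move=> V [oV cV VU]; exact: (leL V U oV oU cV VU).2.
  apply/seteqP; split=> [nu /(sharp_inner oU)[K [cK KU K1]]|nu [V [oV cV VU]]].
    have [V DV KV] := between K cK KU; exists V => //.
    apply: sharpS K1 => //; first by right; exact: metric_compact_closed.
    by case: DV; left.
  apply: Lambda_sub; [by left|by left|].
  exact: subset_trans (@subset_closure _ _) VU.
(* Both sides are outer regular on compact sets: [mu] by definition, [phi] by
   [prob_Lambda_outer]. *)
have muK K : compact K -> mu K = phi K.
  move=> cK; apply/eqP; rewrite eq_le; apply/andP; split.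
    apply: prob_Lambda_outer => // U oU KU.
    rewrite -/(phi U) -muphi//.
    by apply: (tm_le tmu) => //; [right; exact: metric_compact_closed|left].
  rewrite (tm_closed tmu (metric_compact_closed cK)).
  apply: le_ereal_inf_tmp => _ [U [oU KU] <-]; rewrite muphi//.
  by apply: prob_Lambda_le => //; [right|left].
apply/funext => A; rewrite /comp_Lambda /extend_oc; case: asboolP.
  by move=> [/muphi|/muK].
move=> nocA; case: asboolP => cA.
  rewrite (tm_closed tmu cA); congr ereal_inf; apply: eq_imagel => U [oU _].
  exact: muphi.
by apply: (tm_junk tmu) => -[oA|//]; apply: nocA; left.
Qed.

End FixedProbability.

(** [mu K = 1] is a weighted mean of the numbers [mu (q j K)], none above 1, so each one with
    positive weight equals 1. *)
Lemma adjoint_Dset (mu : set X -> \bar R) i : topological_measure dfc mu ->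
  markov_tm alpha q mu = mu -> mu setT <= 1 ->
  \sum_(0 <= i <oo) (alpha i)%:E = 1 -> (0 < alpha i)%R ->
  Q i @` Dset mu `<=` Dset mu.
Proof.
move=> tmu fixmu mu1 a1 ai0 _ [nu nuD <-] K [cK K1].
have cqK j : compact (q j K) by exact: (it_compact (itq j)).
have mu1' j : mu (q j K) <= 1.
  apply: le_trans mu1; apply: (tm_le tmu) => //; last by left; exact: openT.
  by right; exact: metric_compact_closed.
suff qK1 : mu (q i K) = 1.
  by rewrite /Lambda /= (sharp_adjoint (Qq i)); [exact: nuD|right].
apply/eqP; rewrite eq_le mu1' /= leNgt; apply/negP => lt1.
have : \sum_(0 <= j <oo) (alpha j)%:E * mu (q j K) < \sum_(0 <= j <oo) (alpha j)%:E.
  rewrite [ltLHS](nneseriesD1 (n := i)) => //; last first.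
    by move=> j _; rewrite mule_ge0 ?lee_fin// (tm_ge0 tmu).
  rewrite [ltRHS](nneseriesD1 (n := i)) => //; last by move=> j _; rewrite lee_fin.
  have rest : \sum_(0 <= j <oo | true && (j != i)) (alpha j)%:E * mu (q j K) <=
      \sum_(0 <= j <oo | true && (j != i)) (alpha j)%:E.
    apply: lee_nneseries => [j _ _|j _].
      by rewrite mule_ge0 ?lee_fin// (tm_ge0 tmu).
    by rewrite -[leRHS]mule1 lee_wpmul2l// lee_fin.
  apply: (lte_leD _ _ rest); last by rewrite -[ltRHS]mule1 lte_pmul2l// lte_fin.
  rewrite ge0_fin_numE; last first.
    by apply: nneseries_ge0 => j _ _; rewrite mule_ge0 ?lee_fin// (tm_ge0 tmu).
  apply: (le_lt_trans rest); apply: (le_lt_trans _ (ltry 1)).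
  rewrite -a1 [leRHS](nneseriesD1 (n := i)) => //; first by rewrite leeDr ?lee_fin.
  by move=> j _; rewrite lee_fin.
by have := markov_tm_oc mu (or_intror cK); rewrite fixmu K1 => <-; rewrite a1 ltxx.
Qed.

End FixedPoints.

(** * The mass of a representable measure *)

Section QuasiIntegralBounds.
Import measurable_realfun.
Context {R : realType} {X : pmetricType R}.
Implicit Types (phi : set X -> \bar R) (f : X -> R).

Lemma measurable_sup_level phi f :
  (forall U V, open U -> open V -> U `<=` V -> phi U <= phi V) ->
  (forall U, open U -> phi U \is a fin_num) -> continuous f ->
  measurable_fun [set: R] ((fun t => phi (sup_level f t)) : R -> \bar R).
Proof.
move=> phiS phifin fc; have oL t : open (sup_level f t) by exact: open_sup_level.
rewrite (_ : (fun t => _) = EFin \o (fun t : R => fine (phi (sup_level f t)))).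
  apply/measurable_EFinP; apply: nonincreasing_measurable => // t t' tt'.
  apply: fine_le; [exact: phifin|exact: phifin|].
  by apply: phiS => // x /=; exact: le_lt_trans.
by apply/funext => t /=; rewrite fineK//; exact: phifin.
Qed.

Context {phi : set X -> \bar R} {f : X -> R} {c k : R}.
Hypothesis fc : continuous f.
Hypothesis f0c : forall x, (0 <= f x <= c)%R.
Hypothesis phi0 : forall U, open U -> 0 <= phi U.
Hypothesis phiS : forall U V, open U -> open V -> U `<=` V -> phi U <= phi V.

Let a := inf (range f).
Let b := sup (range f).

Let rf0 : range f !=set0. Proof. by exists (f point), point. Qed.
Let lbf : has_lbound (range f).
Proof. by exists 0%R => _ [x _ <-]; have /andP[] := f0c x. Qed.
Let ubf : has_ubound (range f).
Proof. by exists c => _ [x _ <-]; have /andP[] := f0c x. Qed.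

Let a0 : (0 <= a)%R.
Proof. by apply: lb_le_inf => // _ [x _ <-]; have /andP[] := f0c x. Qed.
Let ab : (a <= b)%R.
Proof.
by apply: (@le_trans _ _ (f point)); [exact: ge_inf|exact: ub_le_sup].
Qed.
Let bc : (b <= c)%R.
Proof. by apply: ge_sup => // _ [x _ <-]; have /andP[] := f0c x. Qed.

Let oL t : open (sup_level f t). Proof. exact: open_sup_level. Qed.

Let itv_mass (r : R) :
  \int[lebesgue_measure]_(t in `[a, b]) (cst r%:E t) = (r * (b - a))%:E.
Proof.
rewrite integral_cst// EFinM; congr (_ * _).
apply: eq_trans (lebesgue_measure_itv _) _; rewrite /= lte_fin.
by case: ltP => // h; congr EFin; move: ab; lra.
Qed.

Let int_le (r : R) : (forall U, open U -> phi U <= r%:E) ->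
  \int[lebesgue_measure]_(t in `[a, b]) phi (sup_level f t) <= (r * (b - a))%:E.
Proof.
move=> phir; rewrite -itv_mass; apply: ge0_le_integral => //.
- by move=> t _; exact: phi0.
- apply: measurable_funTS; apply: measurable_sup_level => // U oU.
  by rewrite ge0_fin_numE ?phi0// (le_lt_trans (phir U oU))// ltry.
- by move=> t _; exact: phir.
Qed.

(** The integral contributes at most [b - a] and, since [0 <= a], the correction term at most [a];
    together at most [b]. *)
Lemma qint_le_prob : (forall U, open U -> phi U <= 1) -> (qint f phi <= c)%R.
Proof.
move=> phi1; have := int_le phi1; rewrite mul1r /qint -/a -/b => h.
have h1 : (fine (phi setT) <= 1)%R.
  rewrite -lee_fin fineK ?phi1 ?ge0_fin_numE ?phi0//; try exact: openT.
  by apply: le_lt_trans (phi1 _ openT) (ltry 1).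
apply: le_trans bc; rewrite -[leRHS](subrK a); apply: lerD; last first.
  by rewrite -[leRHS]mulr1 ler_wpM2l.
have I0 : 0 <= \int[lebesgue_measure]_(t in `[a, b]) phi (sup_level f t).
  by apply: integral_ge0 => t _; exact: phi0.
by rewrite -lee_fin fineK// ge0_fin_numE// (le_lt_trans h)// ltry.
Qed.

(** The integral gives [k * (c - a)]; the missing [a * k] comes from the term with the total mass,
    which is at least [k]. *)
Lemma qint_ge_const (x0 : X) : phi setT < +oo -> f x0 = c ->
  (forall t, (t < c)%R -> k%:E <= phi (sup_level f t)) -> (0 <= k)%R ->
  (c * k <= qint f phi)%R.
Proof.
move=> phioo fx0 kphi k0.
have phiT : phi setT = (fine (phi setT))%:E.
  by rewrite fineK// ge0_fin_numE ?phi0//; exact: openT.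
set M := fine (phi setT) in phiT.
have phiM U : open U -> phi U <= M%:E.
  by move=> oU; rewrite -phiT; apply: phiS => //; exact: openT.
have bE : b = c.
  by apply/eqP; rewrite eq_le bc /= -fx0; apply: ub_le_sup => //; exists x0.
have kM : (k <= M)%R.
  by rewrite -lee_fin; apply: le_trans (kphi (c - 1)%R _) (phiM _ (oL _)); rewrite gtrBl.
have up := int_le phiM.
have low : (k * (b - a))%:E <= \int[lebesgue_measure]_(t in `[a, b]) phi (sup_level f t).
  have mL : measurable_fun [set: R] ((fun t => phi (sup_level f t)) : R -> \bar R).
    apply: measurable_sup_level => // U oU.
    by rewrite ge0_fin_numE ?phi0// (le_lt_trans (phiM U oU))// ltry.
  (* The endpoint [b = c] is removed because [kphi] covers only levels below [c]. *)
  rewrite -itv_mass -!integral_itv_bndo_bndc; [|exact: measurable_funTS|exact: measurable_cst].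
  apply: ge0_le_integral => //.
  - exact: measurable_funTS.
  - by move=> t /=; rewrite in_itv /= bE => /andP[_]; exact: kphi.
rewrite /qint -/a -/b -/M.
have : (k * (b - a) <= fine (\int[lebesgue_measure]_(t in `[a, b]) phi (sup_level f t)))%R.
  by move: low up; case: (\int[_]_(_ in _) _) => //= r; rewrite !lee_fin.
have : (a * k <= a * M)%R by rewrite ler_wpM2l.
rewrite bE; lra.
Qed.

End QuasiIntegralBounds.

Section Representable.
Context {R : realType} {X : pmetricType R} {dfc : bool}.
Hypothesis lcX : locally_compact [set: X].

(** [qint f] is weakly continuous, so a closed bound valid on the convex hull passes to its closure.
    On the hull the bound needs only monotonicity and values between 0 and 1. *)
Lemma representable_qint_le (mu : set X -> \bar R) (f : X -> R) (c : R) :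
  C0plus f -> (forall x, f x <= c)%R -> representable dfc mu ->
  (qint f mu <= c)%R.
Proof.
move=> Cf fc [_ hull].
have f0c x : (0 <= f x <= c)%R by rewrite fc (Cf.2 x).
pose F : initial_topology (@qint_family R X) -> R := qint f.
have cF : continuous F.
  pose i : set_type (@C0plus R X) := SigSub (mem_set Cf).
  pose ev (g : {ptws set_type (@C0plus R X) -> R}) : R := g i.
  have cev : continuous ev by exact: (@proj_continuous _ _ i).
  change (continuous (ev \o (@qint_family R X : initial_topology (@qint_family R X) -> _))).
  move=> nu; apply: continuous_comp; last exact: cev.
  exact: initial_continuous.
have clF : closed (F @^-1` [set r | (r <= c)%R]).
  by apply: closed_comp => [nu _|]; [exact: cF|exact: closed_le].
have : (F @^-1` [set r | (r <= c)%R]) mu.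
  apply: clF; apply: (closure_subset _ hull).
  move=> _ [n [w [nu [w0 w1 ->]]]].
  apply: qint_le_prob => //.
  - exact: Cf.1.1.
  - by move=> U oU; apply: sume_ge0 => i _; rewrite mule_ge0 ?lee_fin// (tm_ge0 (sharp_tm _)).
  - move=> U V oU oV UV; apply: lee_sum => i _; apply: lee_wpmul2l; first by rewrite lee_fin.
    by apply: (tm_le (sharp_tm _)) => //; left.
  - move=> U oU; apply: (@le_trans _ _ (\sum_i (w i)%:E)).
      apply: lee_sum => i _; rewrite -[leRHS]mule1; apply: lee_wpmul2l; first by rewrite lee_fin.
      by apply: sharp_le1; left.
    by rewrite sumEFin w1.
by [].
Qed.

(** A bump function of height [c] on [K] has quasi-integral at least [c * mu K] and at most [c];
    inner regularity then bounds the total mass. *)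
Lemma representable_le1 (mu : set X -> \bar R) :
  representable dfc mu -> mu setT < +oo -> mu setT <= 1.
Proof.
move=> rmu muoo; have tmu := rmu.1.
have fin A : open A \/ closed A -> mu A \is a fin_num.
  move=> hA; rewrite ge0_fin_numE ?(tm_ge0 tmu)//; apply: le_lt_trans muoo.
  by apply: (tm_le tmu) => //; left; exact: openT.
apply: (tm_inner tmu); first exact: openT.
move=> K cK _; have clK := metric_compact_closed cK.
(* An empty [K] offers no point where the bump function attains [c]; there additivity gives mass
   0. *)
have [K0|/set0P[x0 Kx0]] := eqVneq K set0.
  have fin0 : mu set0 \is a fin_num by apply: fin; left; exact: open0.
  have := tm_compact_superadd tmu compact0 compact0 (set0I _) (or_introl open0).
  by rewrite setU0 => /(_ (@subset_refl _ _)); rewrite K0 -(fineK fin0) -EFinD !lee_fin; lra.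
have [f [c [c0 tf f0c fK _]]] := bump_function lcX cK openT (@subsetT _ K).
have [[fc _] [[_ cf] _]] := tf.
have Cf : C0plus f.
  split; last by move=> x; have /andP[] := f0c x.
  split=> // e e0; apply: subclosed_compact cf _.
    have -> : [set x | (e <= `|f x|)%R] =
      ((fun r : R => `|r|%R) \o f) @^-1` [set r | (e <= r)%R] by [].
    apply: closed_comp => [x _|]; last exact: closed_ge.
    by apply: continuous_comp; [exact: fc|exact: norm_continuous].
  move=> x /= ex; apply: subset_closure => /=.
  by rewrite -normr_gt0 (lt_le_trans e0).
have fc' x : (f x <= c)%R by have /andP[] := f0c x.
have h1 := representable_qint_le Cf fc' rmu.
have finK := fin K (or_intror clK).
have : (c * fine (mu K) <= qint f mu)%R.
  apply: (qint_ge_const fc f0c _ _ muoo (fK x0 Kx0)) => //.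
  - by move=> U _; exact: tm_ge0 tmu U.
  - by move=> U V oU oV; apply: (tm_le tmu); left.
  - move=> t tc; rewrite fineK//; apply: (tm_le tmu); [by right|left; exact: open_sup_level|].
    by move=> x /fK /= ->.
  - by rewrite fine_ge0// (tm_ge0 tmu).
move=> /le_trans/(_ h1); rewrite -[leRHS]mulr1 ler_pM2l// => h.
by rewrite -(fineK finK) lee_fin.
Qed.

End Representable.

(** * Compatibility of the two Markov operators *)

Section MarkovLambda.
Context {R : realType} {X : pmetricType R}.

(** Serves closed noncompact sets, whose value is an infimum over open neighbourhoods. Values at
    most 1 make the tails uniformly small, and finitely many near-minimisers are replaced by their
    intersection. *)
Lemma nneseries_inf_directed (alpha : nat -> R) (D : set (set X))
    (phi : nat -> set X -> \bar R) :
  (forall i, (0 <= alpha i)%R) -> \sum_(0 <= i <oo) (alpha i)%:E <= 1 ->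
  D !=set0 -> (forall U V, D U -> D V -> D (U `&` V)) ->
  (forall i U V, D U -> D V -> U `<=` V -> phi i U <= phi i V) ->
  (forall i U, 0 <= phi i U) -> (forall i U, D U -> phi i U <= 1) ->
  \sum_(0 <= i <oo) (alpha i)%:E * ereal_inf [set phi i U | U in D] =
  ereal_inf [set \sum_(0 <= i <oo) (alpha i)%:E * phi i U | U in D].
Proof.
move=> a0 a1 [U0 DU0] DI phiS phi0 phi1.
pose I i := ereal_inf [set phi i U | U in D].
have I0 i : 0 <= I i by apply: le_ereal_inf_tmp => _ [U _ <-].
have Ile i U : D U -> I i <= phi i U.
  by move=> DU; apply: ereal_inf_lbound; exists U.
have Ifin i : I i \is a fin_num.
  by rewrite ge0_fin_numE// (le_lt_trans (Ile i _ DU0))// (le_lt_trans (phi1 i _ DU0))// ltry.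
apply/eqP; rewrite eq_le; apply/andP; split.
  apply: le_ereal_inf_tmp => _ [U DU <-]; apply: lee_nneseries => [i _ _|i _].
    by apply: mule_ge0; [rewrite lee_fin|exact: I0].
  by apply: lee_wpmul2l; [rewrite lee_fin|exact: Ile].
have aI0 i : 0 <= (alpha i)%:E * I i by apply: mule_ge0; rewrite ?lee_fin.
apply/lee_addgt0Pr => e e0; have e20 : (0 < e / 2)%R by rewrite divr_gt0.
have aoo : \sum_(0 <= i <oo | true) (alpha i)%:E < +oo.
  exact: le_lt_trans a1 (ltry 1).
have [N tailN] : exists N, \sum_(N <= i <oo) (alpha i)%:E <= (e / 2)%:E.
  have ae0 i : true -> 0 <= (alpha i)%:E by rewrite lee_fin.
  have /fine_cvgP[fint /cvgrPdist_lt/(_ _ e20) ct] := nneseries_tail_cvg aoo ae0.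
  have [N _ h] := filterI fint ct; exists N.
  have [/= fN dN] := h N (leqnn N).
  rewrite -(fineK fN) lee_fin; apply: ltW; apply: le_lt_trans dN.
  by rewrite sub0r normrN ler_norm.
have [U DU UN] : exists2 U, D U & forall i, (i < N)%N -> phi i U <= I i + (e / 2)%:E.
  elim: N {tailN} => [|N [U DU IH]]; first by exists U0.
  have : I N < I N + (e / 2)%:E by rewrite lteDl// lte_fin.
  move=> /ereal_inf_lt[_ [V DV <-] VN]; exists (U `&` V); first exact: DI.
  move=> i; rewrite ltnS leq_eqVlt => /orP[/eqP ->|iN].
    by apply: le_trans (ltW VN); apply: phiS => //; exact: DI.
  by apply: le_trans (IH i iN); apply: phiS => //; exact: DI.
apply: (@le_trans _ _ (\sum_(0 <= i <oo) (alpha i)%:E * phi i U)).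
  by apply: ereal_inf_lbound; exists U.
rewrite (nneseries_split 0 N); last by move=> i _; rewrite mule_ge0 ?lee_fin.
rewrite [X in _ <= X + _](nneseries_split 0 N); last by move=> i _.
have h1 : \sum_(0 <= i < 0 + N) (alpha i)%:E * phi i U <=
    \sum_(0 <= i < 0 + N) (alpha i)%:E * I i + (e / 2)%:E.
  apply: (@le_trans _ _ (\sum_(0 <= i < 0 + N) ((alpha i)%:E * I i + (e / 2)%:E * (alpha i)%:E))).
    rewrite !big_seq; apply: lee_sum => i; rewrite mem_index_iota add0n => /andP[_ iN].
    rewrite [(e / 2)%:E * _]muleC -ge0_muleDr ?lee_fin ?(ltW e20)//.
    by apply: lee_wpmul2l; [rewrite lee_fin|exact: UN].
  rewrite big_split /= leeD2l// -ge0_sume_distrr; last by move=> i _; rewrite lee_fin.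
  rewrite -[leRHS]mule1 lee_wpmul2l ?lee_fin ?(ltW e20)//; apply: le_trans a1.
  by apply: nneseries_lim_ge => i _ _; rewrite lee_fin.
have h2 : \sum_(0 + N <= i <oo) (alpha i)%:E * phi i U <= (e / 2)%:E.
  apply: le_trans tailN; rewrite add0n; apply: lee_nneseries => [i _ _|i _].
    by apply: mule_ge0; rewrite ?lee_fin.
  by rewrite -[leRHS]mule1 lee_wpmul2l ?lee_fin// phi1.
apply: le_trans (leeD h1 h2) _.
rewrite -addeA -EFinD -splitr leeD2r// leeDl//.
by apply: nneseries_ge0 => i _ _.
Qed.

Context {dfc : bool}.
Hypothesis lcX : locally_compact [set: X].
Context {q : nat -> set X -> set X} {Q : nat -> sharp X dfc -> sharp X dfc}.
Context {alpha : nat -> R}.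
Hypothesis itq : forall i, image_transformation dfc (q i).
Hypothesis alpha0 : forall i, (0 <= alpha i)%R.
Hypothesis alpha1 : \sum_(0 <= i <oo) (alpha i)%:E <= 1.
Hypothesis Qq : forall i, is_adjoint (q i) (Q i).

Lemma comp_Lambda_oc (m : set (sharp X dfc) -> \bar R) (A : set X) :
  open A \/ compact A -> comp_Lambda m A = m (Lambda A).
Proof. by move=> hA; rewrite /comp_Lambda /extend_oc asboolT. Qed.

(** On open and compact sets this is [adjoint_preimage_Lambda] term by term; on other closed sets
    the infimum has to move through the series. *)
Lemma markov_tm_comp_Lambda (m : probability (borel_sharp X dfc) R) :
  markov_tm alpha q (comp_Lambda m) = comp_Lambda (markov_prob alpha Q m).
Proof.
have oc i U : open U \/ compact U -> open (q i U) \/ compact (q i U).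
  by move=> hU; exact: (image_transformation_oc (itq i)).
have Soc A : open A \/ compact A ->
    markov_tm alpha q (comp_Lambda m) A = comp_Lambda (markov_prob alpha Q m) A.
  move=> hA; rewrite markov_tm_oc// comp_Lambda_oc// (markov_prob_Lambda Qq)//.
  by apply: eq_eseriesr => i _; rewrite comp_Lambda_oc//; exact: oc.
apply/funext => A; have [/Soc//|nA] := pselect (open A \/ compact A).
rewrite [RHS]/comp_Lambda [RHS]/extend_oc asboolF//.
have [cA|ncA] := pselect (closed A); last first.
  rewrite asboolF//; apply: eseries0 => i _ _.
  by rewrite /adjoint /extend_oc !asboolF// mule0.
rewrite asboolT//; pose D : set (set X) := [set U | open U /\ A `<=` U].
rewrite (_ : [set _ | U in _] =
    [set \sum_(0 <= i <oo) (alpha i)%:E * m (Lambda (q i U)) | U in D]); last first.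
  by apply: eq_imagel => U [oU _]; rewrite (markov_prob_Lambda Qq)//; left.
rewrite -nneseries_inf_directed//.
- apply: eq_eseriesr => i _; congr (_ * _).
  rewrite /adjoint {1}/extend_oc asboolF// asboolT//; congr ereal_inf.
  by apply: eq_imagel => U [oU _]; rewrite comp_Lambda_oc//; apply: oc; left.
- by exists setT; split=> //; exact: openT.
- by move=> U V [oU AU] [oV AV]; split; [exact: openI|rewrite subsetI].
- move=> i U V [oU _] [oV _] UV; apply: prob_Lambda_le => //; try (by apply: oc; left).
  exact: (image_transformation_open_sub (itq i)).
- move=> i U [oU _]; apply: probability_le1; apply: measurable_Lambda => //.
  by apply: oc; left.
Qed.

End MarkovLambda.

(** * Limits of ultrafilters of simple measures *)

Section UltrafilterLimit.
Context {R : realType} {X : pmetricType R} {dfc : bool}.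
Hypothesis lcX : locally_compact [set: X].
Context {F : set_system (sharp X dfc)}.
Hypothesis FU : UltraFilter F.
Context {K0 : set X}.
Hypotheses (cK0 : compact K0) (FK0 : F (Lambda K0)).
Implicit Types (A B C U V : set X).

Let ultraN U : ~ F (Lambda U) -> F [set nu | nu U <> 1].
Proof. by have [//|h] := in_ultra_setVsetC (Lambda U) FU. Qed.

Lemma sharp_split (nu : sharp X dfc) A B :
  additivity_class dfc A -> additivity_class dfc B ->
  additivity_class dfc (A `|` B) -> A `&` B = set0 ->
  nu (A `|` B) = 1 -> nu A = 1 \/ nu B = 1.
Proof.
have oc C : additivity_class dfc C -> open C \/ closed C.
  rewrite /additivity_class; case: (dfc) => /= [cC|[oC|cC]]; [|by left|];
    by right; exact: metric_compact_closed.
move=> hA hB hAB AB; rewrite (tm_additive (sharp_tm nu) hA hB hAB AB).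
have [->|->] := simple_tm_01 (sharpP nu) (oc A hA); last by left.
have [->|->] := simple_tm_01 (sharpP nu) (oc B hB); last by right.
by rewrite adde0 => /eqP; rewrite eq_sym onee_eq0.
Qed.

(** Eventual value 1 on an open set need not survive in the limit, since mass may drift to the
    boundary. So the limit is first outer regularised on compact sets, then inner regularised on
    open sets. *)
Definition ultra_compact C := forall U, open U -> C `<=` U -> F (Lambda U).

(* The sets of value 1 under the limit of F, in one clause that covers both open
   and closed sets. *)
Definition ultra_one A := forall U, open U -> A `<=` U ->
  exists C, [/\ compact C, C `<=` U & ultra_compact C].

Let one_open U : open U ->
  ultra_one U <-> exists C, [/\ compact C, C `<=` U & ultra_compact C].
Proof.
move=> oU; split=> [h|[C [cC CU LC]] V oV UV]; first exact: h.
by exists C; split=> //; exact: subset_trans UV.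
Qed.

Let one_compact C : compact C -> ultra_one C <-> ultra_compact C.
Proof.
move=> cC; split=> [h U oU CU|LC U oU CU]; last by exists C.
by have [C' [_ C'U]] := h U oU CU; apply.
Qed.

Let one_sub A B : A `<=` B -> ultra_one A -> ultra_one B.
Proof. by move=> AB h U oU BU; apply: h => //; exact: subset_trans BU. Qed.

Let one_inner A : open A \/ compact A -> ultra_one A ->
  exists C, [/\ compact C, C `<=` A & ultra_compact C].
Proof.
move=> [oA /(one_open oA)//|cA /(one_compact cA) LA]; by exists A; split.
Qed.

Let Lambda_mono A B : open A \/ compact A -> open B \/ compact B -> A `<=` B ->
  F (Lambda A) -> F (Lambda B).
Proof. by move=> hA hB AB; apply: filterS; exact: Lambda_sub. Qed.

(** Disjoint compact sets have disjoint open neighbourhoods, and some [nu] would have value 1 on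
    both. *)
Let one_disj A B : open A \/ compact A -> open B \/ compact B ->
  A `&` B = set0 -> ultra_one A -> ultra_one B -> False.
Proof.
move=> hA hB AB /(one_inner hA)[C [cC CA LC]] /(one_inner hB)[D [cD DB LD]].
have oD : open (~` D) by apply: closed_openC; exact: metric_compact_closed.
have CD : C `<=` ~` D.
  by move=> x Cx Dx; have : (A `&` B) x := conj (CA _ Cx) (DB _ Dx); rewrite AB.
have [V [oV CV VD cV]] := compact_open_between lcX cC oD CD.
have oV' : open (~` closure V) by apply: closed_openC; exact: closed_closure.
have DV' : D `<=` ~` closure V by move=> x Dx /VD.
have [nu [nuV nuV']] := filter_ex (filterI (LC V oV CV) (LD _ oV' DV')).
apply: (sharp_disj (nu := nu) (A := V) (B := ~` closure V)) => //; [by left|by left|].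
by rewrite -subset0 => x [/subset_closure].
Qed.

Let compact_setI A U : compact A -> open U -> compact (A `&` ~` U).
Proof.
move=> cA oU; apply: (subclosed_compact _ cA); last exact: subIsetl.
by apply: closedI; [exact: metric_compact_closed|exact: open_closedC].
Qed.

(** If both fail, neighbourhoods [U] and [V] eventually lack value 1. Shrink them to disjoint [W]
    and [V']; a compact set of value 1 in the union falls into two compact pieces, one of which has
    value 1. *)
Let one_split_compact A B : compact A -> compact B -> A `&` B = set0 ->
  ultra_compact (A `|` B) -> ultra_compact A \/ ultra_compact B.
Proof.
move=> cA cB AB LAB; apply: contrapT => /not_orP[].
move=> /existsNP[U /not_implyP[oU /not_implyP[AU /ultraN nU]]].
move=> /existsNP[V /not_implyP[oV /not_implyP[BV /ultraN nV]]].
have oB : open (~` B) by apply: closed_openC; exact: metric_compact_closed.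
have [|W [oW AW WU cW]] := compact_open_between lcX cA (openI oU oB).
  move=> x Ax; split; first exact: AU.
  by move=> Bx; suff : (A `&` B) x by rewrite AB.
pose V' := V `&` ~` closure W.
have oV' : open V' by apply: openI => //; apply: closed_openC; exact: closed_closure.
have /(LAB _ (openU oW oV')) FWV : A `|` B `<=` W `|` V'.
  apply: setUSS => // x Bx; split; first exact: BV.
  by move=> /WU[].
have [nu [nuWV [nuU nuV]]] := filter_ex (filterI FWV (filterI nU nV)).
have [C [cC CWV nuC]] := sharp_inner (openU oW oV') nuWV.
have CE : (C `&` ~` V') `|` (C `&` ~` W) = C.
  rewrite -setIUr; apply/seteqP; split=> x; first by case.
  move=> Cx; split=> //; have [Wx|Wx] := pselect (W x); last by right.
  by left=> -[_]; apply; exact: subset_closure.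
have c1 := compact_setI cC oV'; have c2 := compact_setI cC oW.
have [||||||] := @sharp_split nu (C `&` ~` V') (C `&` ~` W).
- exact: additivity_compact.
- exact: additivity_compact.
- by apply: additivity_compact; rewrite CE.
- by rewrite -subset0 => x [[/CWV [Wx|//] _] [_]].
- by rewrite CE.
- move=> h; apply: nuU; apply: sharpS h => //; [by right; exact: metric_compact_closed|by left|].
  by move=> x [/CWV[Wx|//] _]; have [] := WU x (subset_closure Wx).
- move=> h; apply: nuV; apply: sharpS h => //; [by right; exact: metric_compact_closed|by left|].
  by move=> x [/CWV[//|[]]].
Qed.

(** Here [nu] has to be additive on an open and a compact set together, hence [dfc = false]. A
    neighbourhood of [B] that eventually lacks value 1 is cut away, and the compact remainder inside
    [A] is the witness. *)
Let one_split_mixed A B : dfc = false -> open A -> compact B ->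
  open (A `|` B) \/ compact (A `|` B) -> A `&` B = set0 ->
  ultra_one (A `|` B) -> ultra_one A \/ ultra_one B.
Proof.
move=> dfcF oA cB hAB AB /(one_inner hAB)[C [cC CAB LC]].
have adm D : open D \/ compact D -> additivity_class dfc D by rewrite dfcF.
have [LB|] := pselect (ultra_compact B); first by right; exact/one_compact.
move=> /existsNP[V /not_implyP[oV /not_implyP[BV /ultraN nV]]]; left.
have [oAB|cAB] := hAB.
- have [|V2 [oV2 BV2 V2V cV2]] := compact_open_between lcX cB (openI oV oAB).
    by move=> x Bx; split; [exact: BV|right].
  have [|O [oO CO OAB cO]] := compact_open_between lcX (compactU cC cV2) oAB.
    by rewrite subUset; split => // x /V2V[].
  have BO : closure V2 `<=` O by move=> x ?; apply: CO; right.
  (* Removing the open [V2] keeps the witness compact, whereas [nu] is split along [closure V2] so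
     that the complementary part is open. *)
  apply/(one_open oA); exists (closure O `&` ~` V2); split.
  + exact: compact_setI.
  + by move=> x [/OAB[//|/BV2]].
  + move=> U oU OU.
    have FO : F (Lambda O) by apply: LC => // x ?; apply: CO; left.
    apply: filterS (filterI FO nV) => nu [nuO nuV].
    have oOV : open (O `&` ~` closure V2).
      by apply: openI => //; apply: closed_openC; exact: closed_closure.
    have OE : (O `&` ~` closure V2) `|` closure V2 = O.
      apply/seteqP; split=> x; first by case=> [[]//|/BO].
      by move=> Ox; have [?|?] := pselect (closure V2 x); [right|left].
    have [|||||h|h] := @sharp_split nu (O `&` ~` closure V2) (closure V2).
    * by apply: adm; left.
    * by apply: adm; right.
    * by apply: adm; rewrite OE; left.
    * by rewrite -subset0 => x [[]].
    * by rewrite OE.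
    * apply: sharpS h; [by left|by left|].
      move=> x [Ox nx]; apply: OU; split; first exact: subset_closure.
      by move=> /subset_closure.
    * exfalso; apply: nuV; apply: sharpS h; [by right; exact: closed_closure|by left|].
      by move=> x /V2V[].
- have [V2 [oV2 BV2 V2V cV2]] := compact_open_between lcX cB oV BV.
  have oW : open (A `|` V2) by exact: openU.
  have [|W [oW' KW WA cW]] := compact_open_between lcX cAB oW; first exact: setUS.
  have AW x : A x -> closure W x by move=> Ax; apply/subset_closure/KW; left.
  apply/(one_open oA); exists ((A `|` B) `&` ~` V2); split.
  + exact: compact_setI.
  + by move=> x [[//|/BV2]].
  + move=> U oU OU.
    have FW : F (Lambda W) by apply: LC => //; exact: subset_trans KW.
    apply: filterS (filterI FW nV) => nu [nuW nuV].
    (* The compact rest of [closure W] outside [A'] lies in [V], where [nu] does not have value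
       1. *)
    pose A' := A `&` ~` closure V2.
    have oA' : open A'.
      by apply: openI => //; apply: closed_openC; exact: closed_closure.
    have cE := compact_setI cW oA'.
    have WE : A' `|` (closure W `&` ~` A') = closure W.
      apply/seteqP; split=> x; first by case=> [[/AW]//|[]].
      by move=> Wx; have [?|?] := pselect (A' x); [left|right].
    have [|||||h|h] := @sharp_split nu A' (closure W `&` ~` A').
    * by apply: adm; left.
    * by apply: adm; right.
    * by apply: adm; rewrite WE; right.
    * by rewrite -subset0 => x [? []].
    * rewrite WE; apply: sharpS nuW; [by left|by right; exact: closed_closure|].
      exact: subset_closure.
    * apply: sharpS h; [by left|by left|].
      by move=> x [Ax nx]; apply: OU; split; [left|move=> /subset_closure].
    * exfalso; apply: nuV; apply: sharpS h; [by right; exact: metric_compact_closed|by left|].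
      move=> x [/WA[Ax|V2x] nA']; last by apply: V2V; exact: subset_closure.
      by apply: V2V; apply: contrapT => ?; apply: nA'.
Qed.

Let one_split A B : additivity_class dfc A -> additivity_class dfc B ->
  additivity_class dfc (A `|` B) -> A `&` B = set0 ->
  ultra_one (A `|` B) -> ultra_one A \/ ultra_one B.
Proof.
have split_cc C D : compact C -> compact D -> C `&` D = set0 ->
    ultra_one (C `|` D) -> ultra_one C \/ ultra_one D.
  move=> cC cD CD /(one_compact (compactU cC cD))/(one_split_compact cC cD CD).
  by move=> [?|?]; [left|right]; exact/one_compact.
have [dfcT|dfcF] : dfc = true \/ dfc = false by case: (dfc); [left|right].
  by rewrite /additivity_class dfcT => /= cA cB _; exact: split_cc.
rewrite /additivity_class dfcF /= => -[oA|cA] [oB|cB] hAB AB.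
- move=> /(one_inner hAB)[C [cC CAB LC]].
  have cB := compact_setI cC oB; have cA := compact_setI cC oA.
  have CE : (C `&` ~` B) `|` (C `&` ~` A) = C.
    rewrite -setIUr; apply/seteqP; split=> x; first by case.
    move=> Cx; split=> //; have [Ax|Ax] := pselect (A x); last by right.
    by left=> Bx; suff : (A `&` B) x by rewrite AB.
  have [||h|h] := split_cc _ _ cB cA.
  + by rewrite -subset0 => x [[/CAB[Ax|//] _] [_]].
  + by rewrite CE; exact/one_compact.
  + by left; apply: one_sub h => x [/CAB[]].
  + by right; apply: one_sub h => x [/CAB[]].
- exact: one_split_mixed.
- rewrite setUC => /one_split_mixed h; rewrite or_comm; apply: h => //.
    by rewrite setUC.
  by rewrite setIC.
- exact: split_cc.
Qed.

Let lim_val A : \bar R :=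
  if `[< (open A \/ closed A) /\ ultra_one A >] then 1 else 0.

Let lim_val1 A : open A \/ closed A -> ultra_one A -> lim_val A = 1.
Proof. by move=> hA oneA; rewrite /lim_val asboolT. Qed.

Let lim_val0 A : ~ ultra_one A -> lim_val A = 0.
Proof. by move=> oneA; rewrite /lim_val asboolF// => -[]. Qed.

Let lim_valP A : lim_val A = 1 -> ultra_one A.
Proof.
rewrite /lim_val; case: asboolP => [[]//|_ /eqP].
by rewrite eq_sym onee_eq0.
Qed.

Let lim_val_ge0 A : 0 <= lim_val A.
Proof. by rewrite /lim_val; case: ifP => _; rewrite ?lee01. Qed.

Let lim_val_le1 A : lim_val A <= 1.
Proof. by rewrite /lim_val; case: ifP => _; rewrite ?lee01. Qed.

Let lim_valS A B : open B \/ closed B -> A `<=` B -> lim_val A <= lim_val B.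
Proof.
move=> hB AB; rewrite /lim_val; case: asboolP => [[_ oneA]|_].
  by rewrite asboolT//; split=> //; exact: one_sub oneA.
by case: ifP => _; rewrite ?lee01.
Qed.

Let lim_val_simple : simple_tm dfc lim_val.
Proof.
have oc C : additivity_class dfc C -> open C \/ compact C.
  by rewrite /additivity_class; case: (dfc) => //=; right.
have oc' C : open C \/ compact C -> open C \/ closed C.
  by move=> [oC|cC]; [left|right; exact: metric_compact_closed].
(* [K0] keeps the mass from escaping to infinity. *)
have T1 : lim_val setT = 1.
  apply: lim_val1; first by left; exact: openT.
  move=> U oU TU; exists K0; split=> //; first exact: subset_trans TU.
  by move=> V oV KV; apply: Lambda_mono FK0 => //; [right|left].
split => //; last first.
  by move=> A _; rewrite /lim_val; case: ifP => _; [right|left].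
split => //.
- by move=> A hA; rewrite /lim_val asboolF// => -[].
- by exists setT; [left; exact: openT|rewrite T1].
- move=> A B hA hB hAB AB.
  have [oneA|nA] := pselect (ultra_one A); have [oneB|nB] := pselect (ultra_one B).
  + by have := one_disj (oc _ hA) (oc _ hB) AB oneA oneB.
  + rewrite (lim_val0 nB) adde0 !lim_val1//; try exact/oc'/oc.
    exact: one_sub oneA.
  + rewrite (lim_val0 nA) add0e !lim_val1//; try exact/oc'/oc.
    exact: one_sub oneB.
  + rewrite (lim_val0 nB) (lim_val0 nA) adde0 lim_val0// => /(one_split hA hB hAB AB).
    by case.
- move=> U oU; apply/eqP; rewrite eq_le; apply/andP; split; last first.
    by apply: ge_ereal_sup => _ [K [cK KU] <-]; apply: lim_valS => //; left.
  have [oneU|nU] := pselect (ultra_one U); last first.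
    rewrite (lim_val0 nU); apply: le_trans (lim_val_ge0 set0) _.
    by apply: ereal_sup_ubound; exists set0 => //; split; [exact: compact0|exact: sub0set].
  have [C [cC CU LC]] := one_inner (or_introl oU) oneU.
  apply: ereal_sup_ubound; exists C => //; rewrite !lim_val1//; first by left.
    by right; exact: metric_compact_closed.
  exact/one_compact.
- move=> E cE; apply/eqP; rewrite eq_le; apply/andP; split.
    by apply: le_ereal_inf_tmp => _ [U [oU EU] <-]; apply: lim_valS => //; left.
  have [oneE|] := pselect (ultra_one E).
    rewrite (lim_val1 (or_intror cE) oneE); apply: le_trans (lim_val_le1 setT).
    by apply: ereal_inf_lbound; exists setT => //; split => //; exact: openT.
  move=> nE; have := nE; move=> /existsNP[U /not_implyP[oU /not_implyP[EU nU]]].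
  rewrite (lim_val0 nE); apply: ereal_inf_lbound; exists U => //.
  by apply: lim_val0 => /(one_open oU).
Qed.

Lemma ultra_limit : exists nu0 : sharp X dfc,
  (forall U, open U -> nu0 U = 1 -> F (Lambda U)) /\
  (forall C, compact C -> ultra_compact C -> nu0 C = 1).
Proof.
exists (Sharp lim_val_simple); split=> [U oU /= /lim_valP/(one_open oU)[C [_ CU]]|C cC LC /=].
  exact.
apply: lim_val1; first by right; exact: metric_compact_closed.
exact/one_compact.
Qed.

End UltrafilterLimit.

(** * Convergence of Cauchy ultrafilters *)

Section UltrafilterConvergence.
Context {R : realType} {X : pmetricType R} {dfc : bool}.
Hypothesis lcX : locally_compact [set: X].
Context {F : set_system (sharp X dfc)}.
Hypothesis FU : UltraFilter F.

Lemma ultra_qint (nu0 : sharp X dfc) (f : X -> R) (e : R) :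
  (forall U, open U -> nu0 U = 1 -> F (Lambda U)) ->
  (forall C, compact C -> ultra_compact C (F := F) -> nu0 C = 1) ->
  test_fun dfc 1 f -> (0 < e)%R ->
  F [set nu | (`|qint f nu - qint f nu0| <= e)%R].
Proof.
move=> Flim limF tf e0; have [fc fM] := test_fun_Cc tf.
have [_ [[_ cf] f0]] := tf; set p := qint f nu0.
have oL t : open (sup_level f t) by exact: open_sup_level.
have lt_level (nu : sharp X dfc) t : (t < qint f nu)%R -> nu (sup_level f t) = 1.
  exact: (qint_simple nu fc fM).1.
have level_le (nu : sharp X dfc) t : nu (sup_level f t) = 1 -> (t <= qint f nu)%R.
  exact: (qint_simple nu fc fM).2.
have cptf (A : set X) : closed A -> (forall x, A x -> f x != 0%R) -> compact A.
  move=> clA Af; apply: (subclosed_compact clA cf) => x Ax.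
  by apply: subset_closure; exact: Af.
have low : F [set nu | (p - e <= qint f nu)%R].
  apply: (@filterS _ _ _ (Lambda (sup_level f (p - e)))); first by move=> nu; exact: level_le.
  by apply: Flim => //; apply: lt_level; rewrite ltrBlDr ltrDl.
suff up : F [set nu | (qint f nu <= p + e)%R].
  apply: filterS (filterI low up) => nu /= [h1 h2].
  by rewrite ler_distl h1.
(* For [0 <= p] the set [{p + e <= f}] is compact, since [f] has compact support, so eventual value
   1 on [{p + e < f}] would pass to [nu0]. *)
have [p0|p0] := leP 0%R p.
  have t0 : (0 < p + e)%R by rewrite ltr_wpDl.
  have [FL|FL] := in_ultra_setVsetC (Lambda (sup_level f (p + e))) FU; last first.
    by apply: filterS FL => nu /= nL; rewrite leNgt; apply/negP => /lt_level.
  exfalso; pose C := [set x | (p + e <= f x)%R].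
  have clC : closed C.
    by apply: (@closed_comp _ _ f [set u | (p + e <= u)%R]) => [x _|]; [exact: fc|exact: closed_ge].
  have cC : compact C by apply: cptf => // x /(lt_le_trans t0) /gt_eqF ->.
  have C1 : nu0 C = 1.
    apply: limF => // U oU CU; apply: filterS FL; apply: Lambda_sub; [by left|by left|].
    by move=> x /ltW/CU.
  have : (p + e <= p)%R by apply: (le_qint fc fM (or_intror clC) C1).
  by rewrite gerDl leNgt e0.
(* A negative integral occurs only for topological measures. Now sublevel sets at negative levels
   are the compact ones, and additivity transfers value 1 to [C]. *)
have dfcF : dfc = false.
  apply/negP => d; suff : (0 <= p)%R by rewrite leNgt p0.
  apply: (le_qint fc fM (or_introl openT) (sharpT nu0)) => x _; exact: f0.
(* The bound [p / 2] keeps [t] negative when [p + e] is not. *)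
pose t := (Num.min (p + e) (p / 2))%R.
have pt : (p < t)%R by rewrite lt_min ltrDl e0 /=; lra.
have t0 : (t < 0)%R by rewrite gt_min; apply/orP; right; lra.
have te : (t <= p + e)%R by rewrite ge_min lexx.
pose t' := ((p + t) / 2)%R.
have /andP[pt' tt'] : (p < t' < t)%R by rewrite /t'; apply/andP; split; lra.
pose C := [set x | (f x <= t')%R].
have clC : closed C.
  by apply: (@closed_comp _ _ f [set u | (u <= t')%R]) => [x _|]; [exact: fc|exact: closed_le].
have cC : compact C.
  by apply: cptf => // x /le_lt_trans/(_ (lt_trans tt' t0)) /lt_eqF ->.
have LCE : sup_level f t' `|` C = setT.
  by apply/seteqP; split=> // x _; case: (ltP t' (f x)); [left|right].
have [|||||/level_le|C1] := @sharp_split _ _ _ nu0 (sup_level f t') C.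
- by rewrite dfcF; left.
- by rewrite dfcF; right.
- by rewrite dfcF LCE; left; exact: openT.
- by rewrite -subset0 => x [/=]; rewrite ltNge => /negP.
- by rewrite LCE sharpT.
- by rewrite leNgt pt'.
have oV : open [set x | (f x < t)%R].
  by apply: (@open_comp _ _ f [set u | (u < t)%R]) => [x _|]; [exact: fc|exact: open_lt].
have : F (Lambda [set x | (f x < t)%R]).
  apply: Flim => //; apply: sharpS C1; [by right|by left|].
  by move=> x /= /le_lt_trans; apply.
apply: filterS => nu nuV /=; apply: le_trans te.
by apply: (qint_le fc fM (or_introl oV) nuV) => x /ltW.
Qed.

(** [ultra_qint] gives convergence for one test function at a time. The Cauchy property makes it
    uniform, because the intermediate [nu] may depend on [f] while [c] does not. *)
Lemma ultra_cauchy_cvg (K0 : set X) : compact K0 -> F (Lambda K0) ->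
  (forall d : R, (0 < d)%R -> exists c : sharp X dfc, F (ball c d)) ->
  exists nu0 : sharp X dfc, forall d : R, (0 < d)%R -> F (ball nu0 d).
Proof.
move=> cK0 FK0 cauchy; have [nu0 [Flim limF]] := ultra_limit lcX FU cK0 FK0.
exists nu0 => d d0; have d40 : (0 < d / 4)%R by rewrite divr_gt0.
have [c Fc] := cauchy _ d40.
(* The supremum is at most [2 * (d / 4)]; the factor 3 restores strictness and leaves [d / 4] for
   the last triangle inequality. *)
have cnu0 : ball c (3 * (d / 4))%R nu0.
  rewrite sharp_ballE /=; apply: (@le_lt_trans _ _ (2 * (d / 4))%:E); last first.
    by rewrite lte_fin; lra.
  apply: ge_ereal_sup => _ [f tf <-]; rewrite lee_fin.
  have [nu [cnu nunu0]] := filter_ex (filterI Fc (ultra_qint Flim limF tf d40)).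
  have := ball_qint tf cnu; move: nunu0 => /=; rewrite !ler_norml ltr_norml.
  by move=> /andP[? ?] /andP[? ?]; apply/andP; split; lra.
apply: filterS Fc => nu cnu.
rewrite (_ : d = (3 * (d / 4) + d / 4)%R); last by lra.
by apply: ball_triangle cnu; exact: ball_sym.
Qed.

End UltrafilterConvergence.

(** * The support of the invariant probability *)

Section Support.
Context {R : realType} {X : pmetricType R} {dfc : bool}.
Hypothesis lcX : locally_compact [set: X].
Context {q : nat -> set X -> set X} {Q : nat -> sharp X dfc -> sharp X dfc}.
Context {si alpha : nat -> R} {s : R}.
Hypothesis itq : forall i, image_transformation dfc (q i).
Hypothesis csi : forall i, contractivity_factor dfc (q i) (si i) /\ (si i <= s)%R.
Hypothesis s1 : (s < 1)%R.
Hypothesis alpha0 : forall i, (0 <= alpha i)%R.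
Hypothesis Qq : forall i, is_adjoint (q i) (Q i).
Context {m : probability (borel_sharp X dfc) R}.
Hypothesis fixm : forall B : set (borel_sharp X dfc), measurable B ->
  markov_prob alpha Q m B = m B.
Implicit Types (nu : sharp X dfc).

Let s0 : (0 < s)%R. Proof. by have [c h] := csi 0; exact: contractivity_gt0 c h. Qed.

Let Qball i nu nu' e : ball nu e nu' -> ball (Q i nu) (s * e) (Q i nu').
Proof. by have [c h] := csi i; exact: (adjoint_ball lcX (itq i) (Qq i) c h). Qed.

Let Qopen i (O : set (sharp X dfc)) : open O -> open (Q i @^-1` O).
Proof.
have [c h] := csi i => oO; apply: open_comp => // nu _.
exact: (adjoint_continuous lcX (itq i) (Qq i) c h).
Qed.

Let tbm : nearly_finite m.
Proof. exact: (nearly_finite_fixed lcX itq csi s1 alpha0 Qq fixm). Qed.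

Lemma closed_supp_prob : closed (supp_prob m).
Proof. by apply: open_closedC; apply: bigcup_open => O []. Qed.

Lemma supp_prob_pos nu (O : set (sharp X dfc)) : supp_prob m nu -> open O -> O nu ->
  0 < m O.
Proof.
move=> snu oO Onu; rewrite lt_neqAle measure_ge0 andbT; apply/eqP => O0.
by apply: snu; exists O.
Qed.

(** Without a countable base, the null open sets are treated as a directed family, closed under
    binary unions. *)
Lemma prob_supp_setC : m (~` supp_prob m) = 0.
Proof.
apply/eqP; rewrite eq_le measure_ge0 andbT setCK.
apply: (nearly_finite_directed lcX (U := id) tbm).
- by exists set0; split; [exact: open0|exact: measure0].
- by move=> O [].
- move=> O O' [oO O0] [oO' O'0]; exists (O `|` O') => //; split; first exact: openU.
  apply/eqP; rewrite eq_le measure_ge0 andbT -[leRHS]adde0.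
  rewrite -[X in X + _]O0 -[X in _ + X]O'0.
  by apply: measureU2; exact: open_measurable_sharp.
- by move=> O [_ ->].
Qed.

Lemma prob_meets_supp (B : set (borel_sharp X dfc)) : measurable B -> 0 < m B ->
  B `&` supp_prob m !=set0.
Proof.
move=> mB B0; apply: contrapT => h; move: B0; rewrite ltNge => /negP; apply.
rewrite -prob_supp_setC; apply: le_prob => //.
  by apply: open_measurable_sharp; apply: closed_openC; exact: closed_supp_prob.
by move=> nu Bnu snu; apply: h; exists nu.
Qed.

Lemma adjoint_supp i : (0 < alpha i)%R -> Q i @` supp_prob m `<=` supp_prob m.
Proof.
move=> ai _ [nu snu <-] [V [oV V0] VQnu].
have pO := supp_prob_pos snu (Qopen oV) VQnu.
suff : 0 < m V by rewrite V0 ltxx.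
rewrite -fixm; last exact: open_measurable_sharp.
have t0 j : 0 <= (alpha j)%:E * m (Q j @^-1` V) by rewrite mule_ge0// lee_fin.
apply: (@lt_le_trans _ _ ((alpha i)%:E * m (Q i @^-1` V))).
  by rewrite mule_gt0// lte_fin.
rewrite /markov_prob (nneseriesD1 (n := i)) // leeDl//.
by apply: nneseries_ge0 => j _ _.
Qed.

(** Each simple measure is carried by a bounded set, so [dKR] is finite although its test functions
    have no common bound. *)
Lemma sharp_bounded nu nu' : exists2 r : R, (0 < r)%R & ball nu r nu'.
Proof.
have [K [cK _ K1]] := sharp_inner openT (sharpT nu).
have [K' [cK' _ K1']] := sharp_inner openT (sharpT nu').
have [r r0] := compact_sub_ball point (compactU cK cK').
rewrite subUset => -[Kr K'r]; exists (2 * r + 1)%R; first by lra.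
have oB : open (ball (point : X) r) by exact: open_ball_metric.
have b1 : nu (ball point r) = 1.
  by apply: sharpS K1 => //; [right; exact: metric_compact_closed|left].
have b2 : nu' (ball point r) = 1.
  by apply: sharpS K1' => //; [right; exact: metric_compact_closed|left].
rewrite sharp_ballE /=; apply: le_lt_trans (Lambda_ball_sub r0 b1 b2) _.
by rewrite lte_fin ltrDl.
Qed.

Context {N : nat}.
Hypothesis alphaN : forall i, (N <= i)%N -> alpha i = 0%R.

Let sumN : \sum_(0 <= i < N) (alpha i)%:E = 1.
Proof.
rewrite -(markov_prob_sum1 fixm) (nneseries_split 0 N); last first.
  by move=> i _; rewrite lee_fin.
by rewrite add0n [X in _ + X]eseries0 ?adde0// => i Ni _; rewrite alphaN.
Qed.

Let point0 : sharp X dfc := Sharp (point_mass_simple dfc point).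

(** Images of one point mass under all compositions of [k] of the first [N] maps. *)
Let words k := iter k (adjoint_images (Q := Q) N) [:: point0].

Let words_le k (r : R) : m (balls (words 0) r) <= m (balls (words k) (r * s ^+ k)).
Proof.
elim: k => [|k IH]; first by rewrite expr0 mulr1.
apply: le_trans IH _; rewrite exprS mulrCA.
apply: le_trans (prob_adjoint_images lcX itq csi alpha0 Qq fixm N _ _).
by rewrite -ge0_sume_distrl ?sumN ?mul1e// => i _; rewrite lee_fin.
Qed.

(** All words stay in one ball, and by [words_le] almost all the mass lies within distance 1 of
    words of sufficient length. *)
Lemma prob_bounded : exists2 r : R, (0 < r)%R & m (ball point0 r) = 1.
Proof.
have [L L0 QL] : exists2 L : R, (0 < L)%R &
    forall i, (i < N)%N -> ball point0 L (Q i point0).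
  elim: (N) => [|k [L L0 IH]]; first by exists 1%R.
  have [r r0 rk] := sharp_bounded point0 (Q k point0).
  exists (L + r)%R; first exact: addr_gt0.
  move=> i; rewrite ltnS leq_eqVlt => /orP[/eqP ->|/IH h].
    by apply: le_ball rk; rewrite lerDr ltW.
  by apply: le_ball h; rewrite lerDl ltW.
have s1' : (0 < 1 - s)%R by rewrite subr_gt0.
(* [rho] solves [L + s * rho = rho], so that the maps preserve the ball of radius [rho]. *)
pose rho := (L / (1 - s))%R; have rho0 : (0 < rho)%R by rewrite divr_gt0.
have rhoE : (L + s * rho = rho)%R by rewrite /rho; field; rewrite gt_eqF.
have wordsB k c : c \in words k -> ball point0 rho c.
  elim: k c => [|k IH] c; first by rewrite inE => /eqP ->; exact: ballxx.
  move=> /allpairsP[[i c'] /= [iN /IH c'k ->]].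
  rewrite -rhoE; apply: ball_triangle (Qball i c'k).
  by apply: QL; rewrite mem_iota in iN.
have mball r : measurable (ball point0 r : set (borel_sharp X dfc)).
  by apply: open_measurable_sharp; exact: open_ball_sharp.
exists (rho + 1)%R; first by rewrite addr_gt0.
apply/eqP; rewrite eq_le probability_le1//=.
apply/lee_addgt0Pr => e e0; have [r re] := prob_ball_point_mass lcX (m := m) point e0.
have [k rk] := exists_expr_lt csi s1 r (ltr01 : (0 < 1)%R).
have : m (ball point0 r) <= m (ball point0 (rho + 1)).
  apply: (@le_trans _ _ (m (balls (words 0) r))).
    apply: le_prob => //; first exact: measurable_balls.
    by move=> nu h; exists point0 => //=; rewrite inE.
  apply: le_trans (words_le k r) _; apply: le_prob => //.
    exact: measurable_balls.
  move=> nu [c /wordsB ck h]; apply: ball_triangle ck _; apply: le_ball h; exact: ltW.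
move=> /(le_trans re); rewrite -(fineK (fin_num_measure m _ (mball (rho + 1)%R))).
by rewrite -EFinD !lee_fin; lra.
Qed.

(** A ball of mass exactly 1 shrinks to finitely many small balls of total mass 1, with no error
    term; every neighbourhood of a support point must meet them. *)
Lemma supp_prob_totally_bounded (d : R) : (0 < d)%R ->
  exists l : seq (sharp X dfc), supp_prob m `<=` balls l d.
Proof.
move=> d0; have [r r0 r1] := prob_bounded.
have d20 : (0 < d / 2)%R by rewrite divr_gt0.
have [k rk] := exists_expr_lt csi s1 r d20.
have mb : measurable (balls (words k) (d / 2) : set (borel_sharp X dfc)).
  exact: measurable_balls.
have m1 : 1 <= m (balls (words k) (d / 2)).
  rewrite -r1; apply: (@le_trans _ _ (m (balls (words 0) r))).
    apply: le_prob; [|exact: measurable_balls|].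
      by apply: open_measurable_sharp; exact: open_ball_sharp.
    by move=> nu h; exists point0 => //=; rewrite inE.
  apply: le_trans (words_le k r) _; apply: le_prob => //; first exact: measurable_balls.
  by move=> nu [c ck h]; exists c => //; apply: le_ball h; exact: ltW.
exists (words k) => nu snu.
have pb : 0 < m (ball nu (d / 2)%R).
  by apply: supp_prob_pos snu _ _; [exact: open_ball_sharp|exact: ballxx].
have [nu' [nunu' [c ck cnu']]] : exists nu', ball nu (d / 2)%R nu' /\ balls (words k) (d / 2) nu'.
  apply: contrapT => /forallNP h; move: pb; rewrite ltNge => /negP; apply.
  apply: (@le_trans _ _ (m (~` balls (words k) (d / 2)))).
    apply: le_prob; [|exact: measurableC|].
      by apply: open_measurable_sharp; exact: open_ball_sharp.
    by move=> nu' h1 h2; apply: (h nu').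
  have -> : m (~` balls (words k) (d / 2)) = 1 - m (balls (words k) (d / 2)) :=
    probability_setC m mb.
  by rewrite sube_le0.
by exists c => //; apply: (@ball_splitl _ _ nu').
Qed.

(* A preimage is the limit of an ultrafilter on the support; the values at the
   compact set q_i (closure V) keep it from losing mass. *)
Lemma supp_prob_sub_hutchinson nu : supp_prob m nu ->
  exists2 i, (i < N)%N & (Q i @` supp_prob m) nu.
Proof.
move=> snu.
have meet d : (0 < d)%R -> exists2 i, (i < N)%N &
    (Q i @^-1` ball nu d) `&` supp_prob m !=set0.
  move=> d0; apply: contrapT => /forall2NP h.
  have : 0 < m (ball nu d).
    by apply: supp_prob_pos snu _ _; [exact: open_ball_sharp|exact: ballxx].
  rewrite -fixm; last by apply: open_measurable_sharp; exact: open_ball_sharp.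
  rewrite /markov_prob eseries0 ?ltxx// => i _ _.
  have [iN|Ni] := ltnP i N; last by rewrite alphaN// mul0e.
  have [//|hi] := h i.
  suff -> : m (Q i @^-1` ball nu d) = 0 by rewrite mule0.
  apply/eqP; rewrite eq_le measure_ge0 andbT leNgt; apply/negP => /prob_meets_supp.
  move=> /(_ _)/hi; apply; apply: open_measurable_sharp; apply: Qopen.
  exact: open_ball_sharp.
(* One index has to serve all radii: otherwise each [i < N] fails at some radius, and the least of
   these contradicts [meet]. *)
have [i iN meeti] : exists2 i, (i < N)%N & forall d, (0 < d)%R ->
    (Q i @^-1` ball nu d) `&` supp_prob m !=set0.
  apply: contrapT => /forall2NP h.
  have [d d0 hd] : exists2 d : R, (0 < d)%R & forall i, (i < N)%N ->
      ~ ((Q i @^-1` ball nu d) `&` supp_prob m !=set0).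
    have hN : forall i, (i < N)%N -> exists2 d : R, (0 < d)%R &
        ~ ((Q i @^-1` ball nu d) `&` supp_prob m !=set0).
      by move=> i iN; have [//|/existsNP[d /not_implyP[d0 hd]]] := h i; exists d.
    elim: (N) hN => [|k IH] hN; first by exists 1%R.
    have [|d d0 hd] := IH; first by move=> i ik; apply: hN; exact: ltnW.
    have [d' d'0 hd'] := hN k (ltnSn k).
    exists (Num.min d d'); first by rewrite lt_min d0.
    move=> i; rewrite ltnS leq_eqVlt => /orP[/eqP ->|ik] [nu' [h1 h2]].
      by apply: hd'; exists nu'; split=> //; apply: le_ball h1; rewrite ge_min lexx orbT.
    by apply: (hd _ ik); exists nu'; split=> //; apply: le_ball h1; rewrite ge_min lexx.
  by have [i iN /(hd _ iN)] := meet d d0.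
exists i => //.
pose G := filter_from [set d : R | (0 < d)%R]
  (fun d => (Q i @^-1` ball nu d) `&` supp_prob m).
have GF : ProperFilter G.
  apply: filter_from_proper; last by move=> d; exact: meeti.
  apply: filter_from_filter; first by exists 1%R => /=.
  move=> d d' d0 d'0; exists (Num.min d d') => /=; first by rewrite lt_min; apply/andP.
  move=> nu' [h1 h2]; split; split=> //; apply: le_ball h1; rewrite ge_min lexx ?orbT//.
have [F [FU GsF]] := ultraFilterLemma GF.
have FQ d : (0 < d)%R -> F (Q i @^-1` ball nu d).
  by move=> d0; apply: GsF; exists d => // nu' [].
have Fs : F (supp_prob m) by apply: GsF; exists 1%R => //= nu' [].
have [C [cC _ C1]] := sharp_inner openT (sharpT nu).
have [V [oV CV _ cV]] := compact_open_between lcX cC openT (@subsetT _ C).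
have FK : F (Lambda (q i (closure V))).
  have /nbhs_ballP[d /= d0 dV] : nbhs nu (Lambda V).
    apply: open_nbhs_nbhs; split; first exact: open_Lambda.
    by apply: sharpS C1 => //; [right; exact: metric_compact_closed|left].
  apply: filterS (FQ d d0) => nu' /dV V1; rewrite /Lambda /=.
  rewrite -(sharp_adjoint (Qq i)); last by right.
  by apply: sharpS V1; [left|right; exact: closed_closure|exact: subset_closure].
have cauchy d : (0 < d)%R -> exists c : sharp X dfc, F (ball c d).
  move=> d0; have [l sl] := supp_prob_totally_bounded d0.
  have {sl} : F (balls l d) by apply: filterS Fs.
  elim: l => [|c l IH] Fl; first by have [nu' [c]] := filter_ex Fl.
  have [Fc|Fc] := in_ultra_setVsetC (ball c d) FU; first by exists c.
  apply: IH; apply: filterS (filterI Fl Fc) => nu' [[c' /=]].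
  by rewrite inE => /orP[/eqP ->//|c'l] h _; exists c'.
have [nu1 Fnu1] := ultra_cauchy_cvg lcX FU (it_compact (itq i) cV) FK cauchy.
exists nu1.
  apply: closed_supp_prob => B /nbhs_ballP[d /= d0 dB].
  by have [nu' [h1 h2]] := filter_ex (filterI Fs (Fnu1 d d0)); exists nu'; split=> //; exact: dB.
apply: sharp_ball_eq => // e e0; have e20 : (0 < e / 2)%R by rewrite divr_gt0.
have es0 : (0 < e / 2 / s)%R by rewrite divr_gt0.
have [nu' [h1 h2]] := filter_ex (filterI (Fnu1 _ es0) (FQ _ e20)).
apply: (@ball_splitl _ _ (Q i nu')) => //.
by move: (Qball i h1); rewrite mulrC divfK// gt_eqF.
Qed.

End Support.

(** * Finite families as padded sequences *)

Section FiniteFamilies.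

Lemma eseries_ord (R : realType) (n : nat) (u : nat -> \bar R) :
  (forall i, (n <= i)%N -> u i = 0) ->
  \sum_(0 <= i <oo) u i = \sum_(i < n) u i.
Proof.
move=> u0; apply/cvg_lim => //; apply: cvg_near_cst; exists n => // k /= nk.
rewrite -(big_mkord xpredT) (big_cat_nat _ (n := n))//= [X in _ + X]big_nat_cond.
by rewrite [X in _ + X]big1 ?adde0// => i /andP[/andP[/u0]].
Qed.

(** Weights are padded with 0 and maps with the one of index [j0], so that the sequence inherits the
    hypotheses of the finite family. *)
Definition ord_extend (T : Type) (n : nat) (x : T) (u : 'I_n -> T) (i : nat) : T :=
  if insub i is Some j then u j else x.

Lemma ord_extendE (T : Type) (n : nat) (x : T) (u : 'I_n -> T) (j : 'I_n) :
  ord_extend x u j = u j.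
Proof. by rewrite /ord_extend valK. Qed.

Lemma ord_extend_ge (T : Type) (n : nat) (x : T) (u : 'I_n -> T) (i : nat) :
  (n <= i)%N -> ord_extend x u i = x.
Proof. by move=> ni; rewrite /ord_extend insubF// ltnNge ni. Qed.

Context {R : realType} {X : pmetricType R} {dfc : bool} {n : nat}.
Context {q : 'I_n -> set X -> set X} {Q : 'I_n -> sharp X dfc -> sharp X dfc}.
Context {alpha : 'I_n -> R} {j0 : 'I_n}.

Lemma markov_tm_ord_extend (mu : set X -> \bar R) :
  markov_tm (ord_extend 0%R alpha) (ord_extend (q j0) q) mu =
  markov_tm_fin alpha q mu.
Proof.
apply/funext => A; rewrite /markov_tm (eseries_ord (n := n)).
  by apply: eq_bigr => i _; rewrite !ord_extendE.
by move=> i ni; rewrite ord_extend_ge// mul0e.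
Qed.

Lemma markov_prob_ord_extend (m : set (sharp X dfc) -> \bar R) :
  markov_prob (ord_extend 0%R alpha) (ord_extend (Q j0) Q) m =
  markov_prob_fin alpha Q m.
Proof.
apply/funext => B; rewrite /markov_prob (eseries_ord (n := n)).
  by apply: eq_bigr => i _; rewrite !ord_extendE.
by move=> i ni; rewrite ord_extend_ge// mul0e.
Qed.

End FiniteFamilies.

(** * The case of a simple topological measure *)

Section SimpleFixedPoint.
Context {R : realType} {X : pmetricType R} {dfc : bool}.

Lemma simple_tm_deficient (mu : set X -> \bar R) :
  simple_tm false mu -> simple_tm dfc mu.
Proof.
move=> [[g j p a o c] v t]; split => //; split => // A B hA hB hAB.
have sub C : additivity_class dfc C -> additivity_class false C.
  by rewrite /additivity_class; case: (dfc) => //=; right.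
by apply: a; exact: sub.
Qed.

(** Inner regularity gives one comparison on open sets. The converse splits the space into [K] and
    its complement, which takes the additivity of a topological measure; a deficient [nu0] could
    lose mass there. *)
Lemma Dset_simple (nu0 : sharp X dfc) : simple_tm false nu0 ->
  Dset nu0 = [set nu0].
Proof.
move=> snu0; apply/seteqP; split=> [nu nuD|_ -> K [_]]; last by [].
have le U : open U -> nu0 U = 1 -> nu U = 1.
  move=> oU /(sharp_inner oU)[K [cK KU K1]].
  apply: sharpS KU (nuD K (conj cK K1)); last by left.
  by right; exact: metric_compact_closed.
rewrite /=; apply/esym; apply: sharp_eq => // U oU /(sharp_inner oU)[K [cK KU K1]].
have oK : open (~` K) by apply: closed_openC; exact: metric_compact_closed.
suff : nu0 K = 1.
  by apply: sharpS => //; [right; exact: metric_compact_closed|left].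
have [|||||//|nK1] := @sharp_split _ _ _ (Sharp snu0) K (~` K).
- by right.
- by left.
- by rewrite setUv; left; exact: openT.
- by rewrite setICr.
- by rewrite setUv; exact: sharpT.
- by have := sharp_disj (or_intror cK) (or_introl oK) (setICr K) K1 (le _ oK nK1).
Qed.

End SimpleFixedPoint.

Theorem theorem60 (R : realType) (X : pmetricType R) (dfc : bool)
    (MM : set (set X -> \bar R)) (s : R) (mu0 : set X -> \bar R)
    (m0 : probability (borel_sharp X dfc) R) :
  locally_compact [set: X] ->
  MM `<=` topological_measure dfc ->
  uniformly_bounded MM ->
  (s < 1)%R ->
  representable dfc mu0 ->
  (* countably many (d-)image transformations *)
  (forall (q : nat -> set X -> set X) (si alpha : nat -> R)
      (Q : nat -> sharp X dfc -> sharp X dfc),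
    (forall i, image_transformation dfc (q i)) ->
    (forall i, contractivity_factor dfc (q i) (si i) /\ (si i <= s)%R) ->
    (forall i, (0 <= alpha i)%R) ->
    \sum_(0 <= i <oo) (alpha i)%:E <= 1 ->
    (forall i, is_adjoint (q i) (Q i)) ->
    (forall m : probability (borel_sharp X dfc) R,
      markov_tm alpha q (comp_Lambda m) =
      comp_Lambda (markov_prob alpha Q m)) /\
    (unique_fixed_in MM (markov_tm alpha q) mu0 ->
     unique_fixed_prob (markov_prob alpha Q) m0 ->
     (mu0 setT = 1 -> mu0 = comp_Lambda m0) /\
     (\sum_(0 <= i <oo) (alpha i)%:E = 1 ->
      forall i, (0 < alpha i)%R -> Q i @` Dset mu0 `<=` Dset mu0))) /\
  (* finitely many (d-)image transformations *)
  (forall (n : nat) (q : 'I_n -> set X -> set X) (si alpha : 'I_n -> R)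
      (Q : 'I_n -> sharp X dfc -> sharp X dfc) (A : set (sharp X dfc)),
    (forall i, image_transformation dfc (q i)) ->
    (forall i, contractivity_factor dfc (q i) (si i) /\ (si i <= s)%R) ->
    (forall i, (0 < alpha i)%R) ->
    (\sum_(i < n) alpha i = 1)%R ->
    (forall i, is_adjoint (q i) (Q i)) ->
    unique_fixed_in MM (markov_tm_fin alpha q) mu0 ->
    unique_fixed_prob (markov_prob_fin alpha Q) m0 ->
    is_attractor Q A ->
    [/\ hutchinson Q (Dset mu0) `<=` Dset mu0,
        A = supp_prob m0 /\ supp_prob m0 `<=` Dset mu0 &
        simple_tm false mu0 ->
          exists nu0 : sharp X dfc,
            [/\ nu0 = mu0 :> (set X -> \bar R),
                A = [set nu0], supp_prob m0 = [set nu0], Dset mu0 = [set nu0] &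
                forall B : set (borel_sharp X dfc),
                  measurable B -> m0 B = \d_(nu0 : borel_sharp X dfc) B]]).
Proof.
move=> lcX MMtm [L L0 MML] s1 rmu0; split.
  move=> q si alpha Q itq csi a0 a1 Qq; split.
    by move=> m; exact: markov_tm_comp_Lambda.
  move=> [MMmu0 fixmu0 _] [fixm0 _]; split.
    exact: (fixed_point_barycenter lcX itq csi s1 a0 Qq fixm0 rmu0.1).
  move=> a1' i ai; apply: (adjoint_Dset itq a0 Qq rmu0.1) => //.
  apply: (representable_le1 lcX rmu0).
  exact: le_lt_trans (MML _ MMmu0) (ltry _).
move=> n q si alpha Q A itq csi a0 a1 Qq [MMmu0 fixmu0 _] [fixm0 _] [[clA A0 WA] Auniq].
have mu01 : mu0 setT <= 1.
  apply: (representable_le1 lcX rmu0).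
  exact: le_lt_trans (MML _ MMmu0) (ltry _).
have tmu0 := rmu0.1.
have n0 : (0 < n)%N.
  rewrite lt0n; apply/eqP => n0; move: a1; rewrite big1 => [/eqP|i _].
    by rewrite eq_sym oner_eq0.
  by have := ltn_ord i; rewrite {2}n0.
pose j0 := Ordinal n0.
pose q' := ord_extend (q j0) q; pose Q' := ord_extend (Q j0) Q.
pose al' := ord_extend 0%R alpha; pose si' := ord_extend (si j0) si.
have itq' i : image_transformation dfc (q' i).
  by rewrite /q' /ord_extend; case: insub => [j|]; exact: itq.
have csi' i : contractivity_factor dfc (q' i) (si' i) /\ (si' i <= s)%R.
  by rewrite /q' /si' /ord_extend; case: insub => [j|]; exact: csi.
have Qq' i : is_adjoint (q' i) (Q' i).
  by rewrite /q' /Q' /ord_extend; case: insub => [j|]; exact: Qq.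
have a0' i : (0 <= al' i)%R.
  by rewrite /al' /ord_extend; case: insub => [j|//]; exact: ltW.
have aN i : (n <= i)%N -> al' i = 0%R by exact: ord_extend_ge.
have a1' : \sum_(0 <= i <oo) (al' i)%:E = 1.
  rewrite (eseries_ord (n := n)); last by move=> i /aN ->.
  by under eq_bigr => i _ do rewrite /al' ord_extendE; rewrite sumEFin a1.
have fixmu0' : markov_tm al' q' mu0 = mu0 by rewrite markov_tm_ord_extend.
have fixm0' (B : set (borel_sharp X dfc)) : measurable B -> markov_prob al' Q' m0 B = m0 B.
  by rewrite markov_prob_ord_extend; exact: fixm0.
have al0 (j : 'I_n) : (0 < al' j)%R by rewrite /al' ord_extendE.
have suppA : supp_prob m0 = A.
  apply: Auniq; split.
  - exact: closed_supp_prob.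
  - have [||nu [_ snu]] := prob_meets_supp lcX itq' csi' s1 a0' Qq' fixm0' (B := setT).
    + exact: measurableT.
    + by rewrite probability_setT.
    + by exists nu.
  - apply/seteqP; split=> [nu [j _]|nu snu].
      have := adjoint_supp lcX itq' csi' a0' Qq' fixm0' (al0 j).
      by rewrite /Q' ord_extendE; apply.
    have [i iN] := supp_prob_sub_hutchinson lcX itq' csi' s1 a0' Qq' fixm0' aN snu.
    by rewrite -[i]/(val (Ordinal iN)) /Q' ord_extendE => h; exists (Ordinal iN).
have suppD : supp_prob m0 `<=` Dset mu0.
  move=> nu snu K [cK K1]; apply: contrapT => nuK; apply: snu.
  (* A compact set of mass 1 forces total mass 1, which makes the barycenter formula available. *)
  have mu0T : mu0 setT = 1.
    apply/eqP; rewrite eq_le mu01 /= -K1; apply: (tm_le tmu0) => //.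
      by right; exact: metric_compact_closed.
    by left; exact: openT.
  have := fixed_point_barycenter lcX itq' csi' s1 a0' Qq' fixm0' tmu0 fixmu0' mu0T.
  move=> /(congr1 (fun phi => phi K)); rewrite comp_Lambda_oc ?K1; last by right.
  have mK : measurable (Lambda K : set (borel_sharp X dfc)).
    by apply: measurable_Lambda => //; right.
  move=> m0K; exists (~` Lambda K) => //; split.
    by apply: closed_openC; exact: closed_Lambda.
  have -> : m0 (~` Lambda K) = 1 - m0 (Lambda K) := probability_setC m0 mK.
  by rewrite -m0K subee.
split=> //.
- move=> nu [j _]; have := adjoint_Dset itq' a0' Qq' tmu0 fixmu0' mu01 a1' (al0 j).
  by rewrite /Q' ord_extendE; apply.
- move=> smu0; pose nu0 : sharp X dfc := Sharp (simple_tm_deficient smu0).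
  have D0 : Dset mu0 = [set nu0] by exact: (Dset_simple (nu0 := nu0)).
  have s0 : supp_prob m0 = [set nu0].
    apply/seteqP; split; first by rewrite -D0.
    case: A0 => nu; rewrite -suppA => snu; have := suppD nu snu.
    by rewrite D0 => <- _ ->.
  exists nu0; split=> //; first by rewrite -suppA.
  move=> B mB.
  have m00 := prob_supp_setC lcX itq' csi' s1 a0' Qq' fixm0'.
  have mS : measurable ([set nu0] : set (borel_sharp X dfc)).
    by rewrite -s0; apply: closed_measurable_sharp; exact: closed_supp_prob.
  rewrite s0 in m00.
  rewrite diracE; case: (boolP (nu0 \in B)) => [/set_mem Bnu0|/negP nB].
    apply/eqP; rewrite eq_le probability_le1//=.
    have : m0 (~` [set nu0]) = 1 - m0 [set nu0] := probability_setC m0 mS.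
    rewrite m00 => /esym/eqP; rewrite sube_eq ?fin_num_measure// add0e => /eqP ->.
    by apply: le_prob => // _ ->.
  apply/eqP; rewrite eq_le measure_ge0 andbT.
  apply: (@le_trans _ _ (m0 (~` [set nu0]))); last by rewrite m00.
  apply: le_prob => //.
    exact: measurableC.
  by move=> nu Bnu nunu0; apply: nB; rewrite -nunu0; exact: mem_set.
Qed.
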